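(* Let $N$ be a compact manifold and $M$ a manifold, and let $E_0\subseteq E_1\subseteq\mathfrak{Emb}(N,M)$ be two subspaces such that: (i) $E_0$ is dense in $E_1$. (ii) For every embedding $\varphi\in E_1$ there exists $\varepsilon(\varphi)>0$ such that the natural map $E_0\cap\mathcal{U}_\varphi(\varepsilon)\to E_1\cap\mathcal{U}_\varphi(\varepsilon)$ induces a weak homotopy equivalence for every $0<\varepsilon<\varepsilon(\varphi)$. Then the inclusion $j:E_0\hookrightarrow E_1$ is a $C^0$-dense weak homotopy equivalence.
   Context: $\mathfrak{Emb}(N,M)$ is the space of smooth embeddings $N\to M$ with the Whitney $C^\infty$ topology; if $N$ has non-empty boundary, all embeddings are required to be fixed (equal to a reference embedding) on an open neighborhood of the boundary. Let $d$ be a distance on $M$ (compatible with its topology). For $\varphi\in\mathfrak{Emb}(N,M)$ and $\varepsilon>0$, $$\mathcal{U}_\varphi(\varepsilon)=\{\psi\in\mathfrak{Emb}(N,M): d(\psi(x),\varphi(N))<\varepsilon\ \text{for all } x\in N\}.$$ The inclusion $j:E_0\hookrightarrow E_1$ is a $C^0$-dense weak homotopy equivalence if: for every $\varepsilon>0$, every compact CW-complex $K$ with subcomplex $G\subseteq K$, and every (continuous) family of embeddings $\varphi^k\in E_1$, $k\in K$, with $\varphi^k\in E_0$ for $k\in G$, there exists a homotopy $\varphi^k_t\in E_1$, $t\in[0,1]$, such that (a) $\varphi^k_0=\varphi^k$ for $k\in K$; (b) $\varphi^k_t=\varphi^k$ for $k\in G$ and all $t$; (c) $\varphi^k_1\in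 E_0$ for all $k\in K$; (d) $\varphi^k_t\in\mathcal{U}_{\varphi^k}(\varepsilon)$ for all $k\in K$, $t\in[0,1]$. *)

(* Defs.v *)
From HB Require Import structures.
From mathcomp Require Import all_boot all_order all_algebra.
From mathcomp Require Import all_classical all_reals all_analysis.

Set Implicit Arguments.
Unset Strict Implicit.
Unset Printing Implicit Defensive.

Import Order.TTheory GRing.Theory Num.Theory numFieldNormedType.Exports.

Local Open Scope classical_set_scope.
Local Open Scope ring_scope.

(** ** Smooth maps between subsets of Euclidean spaces *)

Section EuclideanSmoothness.
Context {R : realType}.

Definition basis_vec n (i : 'I_n) : 'rV[R]_n := delta_mx 0 i.

(* For n > 0 this is {x | 0 <= x_0}; for n = 0 it is the whole point R^0. *)
Definition halfspace n : set 'rV[R]_n :=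
  [set x | forall i : 'I_n, i = 0%N :> nat -> 0 <= x 0 i].

Fixpoint is_Ck_on n m (k : nat) (W : set 'rV[R]_n) (F : 'rV[R]_n -> 'rV[R]_m)
    : Prop :=
  (forall x, W x -> {for x, continuous F}) /\
  if k is k'.+1 then
    forall i : 'I_n, (forall x, W x -> derivable F x (basis_vec i)) /\
      is_Ck_on k' W (fun x => 'D_(basis_vec i) F x)
  else True.

(* Smoothness on an arbitrary subset A of R^n: near each point of A, the map
   extends to a C^oo map on an open subset of R^n. *)
Definition smooth_on n m (A : set 'rV[R]_n) (F : 'rV[R]_n -> 'rV[R]_m) : Prop :=
  forall x, A x -> exists W (G : 'rV[R]_n -> 'rV[R]_m),
    [/\ open W, W x, forall k, is_Ck_on k W G & forall y, W y -> A y -> G y = F y].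

(* Partial derivative relative to the half-space: at an interior point it is
   the usual one, at a boundary point the increment h is restricted to keep
   h e_i + x in the half-space, so that it equals the i-th partial derivative
   of any smooth extension of F. *)
Definition partial n m (i : 'I_n) (F : 'rV[R]_n -> 'rV[R]_m) (x : 'rV[R]_n)
    : 'rV[R]_m :=
  lim ((fun h : R => h^-1 *: (F (h *: basis_vec i + x) - F x))
         @ within [set h : R | halfspace (h *: basis_vec i + x)] 0^').

Definition iter_partial n m (al : seq 'I_n) (F : 'rV[R]_n -> 'rV[R]_m) :=
  foldr (fun i G => partial i G) F al.

Definition jacobian_rows n m (F : 'rV[R]_n -> 'rV[R]_m) (x : 'rV[R]_n)
    : 'M[R]_(n, m) :=
  \matrix_(i < n) partial i F x.

End EuclideanSmoothness.

(** ** Smooth manifolds, possibly with boundary *)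

(* [param] is the inverse of [coord]; the values of [coord] outside [dom] and
   of [param] outside [coord @` dom] are irrelevant. *)
Record half_chart (R : realType) (n : nat) (X : topologicalType) := HalfChart {
  dom : set X;
  coord : X -> 'rV[R]_n;
  param : 'rV[R]_n -> X;
  open_dom : open dom;
  coord_image : exists2 O, open O & coord @` dom = O `&` halfspace (n := n);
  coordK : forall x, dom x -> param (coord x) = x;
  coord_continuous : {within dom, continuous coord};
  param_continuous : {within coord @` dom, continuous param}
}.

Definition smooth_transition (R : realType) n (X : topologicalType)
    (c c' : half_chart R n X) : Prop :=
  smooth_on (coord c @` (dom c `&` dom c')) (coord c' \o param c).

Record manifold (R : realType) (n : nat) := Manifold {
  carrier :> topologicalType;
  manifold_hausdorff : hausdorff_space carrier;
  manifold_second_countable : @second_countable carrier;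
  atlas : set (half_chart R n carrier);
  atlas_cover : forall x, exists2 c, atlas c & dom c x;
  atlas_smooth : forall c c', atlas c -> atlas c' -> smooth_transition c c';
  atlas_maximal : forall c,
    (forall c', atlas c' -> smooth_transition c c' /\ smooth_transition c' c) ->
    atlas c
}.

Definition boundary (R : realType) (n : nat) (N : manifold R n) : set N :=
  [set x | exists2 c, atlas c &
     dom c x /\ exists i : 'I_n, i = 0%N :> nat /\ coord c x 0 i = 0].
Arguments boundary {R n} N.

Section SmoothEmbeddings.
Context {R : realType} {n m : nat}.

Variables (N : manifold R n) (M : manifold R m).

Definition local_rep (c : half_chart R n N) (c' : half_chart R m M) (f : N -> M)
    : 'rV[R]_n -> 'rV[R]_m :=
  coord c' \o f \o param c.

Definition smooth_map (f : N -> M) : Prop :=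
  continuous f /\
  forall c c', atlas c -> atlas c' ->
    smooth_on (coord c @` (dom c `&` f @^-1` dom c')) (local_rep c c' f).

Definition immersive (f : N -> M) : Prop :=
  forall x c c', atlas c -> atlas c' -> dom c x -> dom c' (f x) ->
    row_free (jacobian_rows (local_rep c c' f) (coord c x)).

Definition open_onto_image (f : N -> M) : Prop :=
  forall U, open U -> exists2 V, open V & f @` U = V `&` range f.

Definition smooth_embedding (f : N -> M) : Prop :=
  [/\ smooth_map f, immersive f, injective f & open_onto_image f].

(* The neighborhood of the boundary on which an embedding agrees with [ref] may
   depend on the embedding. The condition is void when the boundary is empty. *)
Record Emb (ref : N -> M) := MkEmb {
  emb_fun :> N -> M;
  emb_smooth : smooth_embedding emb_fun;
  emb_boundary : exists2 O : set N, open O /\ boundary N `<=` O &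
                   forall x, O x -> emb_fun x = ref x
}.

End SmoothEmbeddings.

HB.instance Definition _ (R : realType) n m (N : manifold R n)
  (M : manifold R m) (ref : N -> M) := gen_eqMixin (Emb ref).
HB.instance Definition _ (R : realType) n m (N : manifold R n)
  (M : manifold R m) (ref : N -> M) := gen_choiceMixin (Emb ref).

(** ** The Whitney C^oo topology *)

Section Whitney.
Context {R : realType} {n m : nat} {N : manifold R n} {M : manifold R m}.
Variable ref : N -> M.

(* Families indexed by D : set nat suffice: since N is second countable, a
   locally finite family of nonempty charts is countable. *)
Definition whitney_data (f : Emb ref) (D : set nat)
    (c : nat -> half_chart R n N) (c' : nat -> half_chart R m M)
    (K : nat -> set N) (e : nat -> R) : Prop :=
  (forall x : N, exists2 W, nbhs x W &
     finite_set [set j | D j /\ (dom (c j) `&` W) !=set0]) /\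
  forall j, D j ->
    [/\ atlas (c j) /\ atlas (c' j), compact (K j), K j `<=` dom (c j),
        f @` K j `<=` dom (c' j) & 0 < e j].

(* The maps g that are, for every j in D, within e_j of f on K_j in the charts
   c_j, c'_j, together with all partial derivatives of order at most r. *)
Definition whitney_nbhd (f : Emb ref) (r : nat) (D : set nat)
    (c : nat -> half_chart R n N) (c' : nat -> half_chart R m M)
    (K : nat -> set N) (e : nat -> R) : set (Emb ref) :=
  [set g | forall j, D j -> g @` K j `<=` dom (c' j) /\
     forall x (al : seq 'I_n), K j x -> (size al <= r)%N ->
       `|iter_partial al (local_rep (c j) (c' j) g) (coord (c j) x) -
         iter_partial al (local_rep (c j) (c' j) f) (coord (c j) x)| < e j].

Definition whitney_base : set (set (Emb ref)) :=
  [set B | exists f r D c c' K e,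
     whitney_data f D c c' K e /\ B = whitney_nbhd f r D c c' K e].

End Whitney.

HB.instance Definition _ (R : realType) n m (N : manifold R n)
    (M : manifold R m) (ref : N -> M) :=
  @isSubBaseTopological.Build (Emb ref) (set (Emb ref))
    (whitney_base (ref := ref)) id.

(** ** Weak homotopy equivalences *)

Definition cube {R : realType} n : set 'rV[R]_n :=
  [set x | forall i, 0 <= x 0 i <= 1].
Arguments cube {R} n x.

Definition cube_boundary {R : realType} n : set 'rV[R]_n :=
  [set x | cube n x /\ exists i, x 0 i = 0 \/ x 0 i = 1].
Arguments cube_boundary {R} n x.

Definition open_cube {R : realType} n : set 'rV[R]_n :=
  [set x | forall i, 0 < x 0 i < 1].
Arguments open_cube {R} n x.

Section WeakEquivalence.
Context (R : realType).

(* Representatives of elements of pi_n(X, x0); only the values on the cube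
   matter. *)
Definition spheroid (X : topologicalType) (x0 : X) n (g : 'rV[R]_n -> X) : Prop :=
  {within cube n, continuous g} /\ forall x, cube_boundary n x -> g x = x0.

(* Equality of the classes of g and g' in pi_n(X, x0). *)
Definition homotopic_spheroids (X : topologicalType) (x0 : X) n
    (g g' : 'rV[R]_n -> X) : Prop :=
  exists H : R * 'rV[R]_n -> X,
    [/\ {within `[0, 1]%classic `*` cube n, continuous H},
        forall x, cube n x -> H (0, x) = g x,
        forall x, cube n x -> H (1, x) = g' x &
        forall (t : R) x, 0 <= t <= 1 -> cube_boundary n x -> H (t, x) = x0].

Definition pi_injective (X Y : topologicalType) (f : X -> Y) n (x0 : X) : Prop :=
  forall g g' : 'rV[R]_n -> X, spheroid x0 g -> spheroid x0 g' ->
    homotopic_spheroids (f x0) (f \o g) (f \o g') -> homotopic_spheroids x0 g g'.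

Definition pi_surjective (X Y : topologicalType) (f : X -> Y) n (x0 : X) : Prop :=
  forall s : 'rV[R]_n -> Y, spheroid (f x0) s ->
    exists2 g : 'rV[R]_n -> X, spheroid x0 g &
      homotopic_spheroids (f x0) (f \o g) s.

(* Since the 0-dimensional cube is a point with empty boundary, the case n = 0
   is bijectivity on path components; the second conjunct is the part of it
   that is lost when X has no base point. *)
Definition weak_homotopy_equivalence (X Y : topologicalType) (f : X -> Y) : Prop :=
  [/\ continuous f,
      [set: Y] !=set0 -> [set: X] !=set0 &
      forall n (x0 : X), pi_injective f n x0 /\ pi_surjective f n x0].

End WeakEquivalence.
Arguments weak_homotopy_equivalence R {X Y} f.

Definition subset_incl (T : Type) (A B : set T) (AB : A `<=` B) (x : A) : B :=
  exist _ (set_val x) (mem_set (AB _ (set_valP x))).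

(** ** CW complexes *)

Definition open_cell (R : realType) (K : topologicalType) n (h : 'rV[R]_n -> K)
    : set K :=
  h @` open_cube n.

(* The closed cube is used as the model of the closed n-disk. *)
Record CW_structure (R : realType) (K : topologicalType) := CWStructure {
  cell : Type;
  cell_dim : cell -> nat;
  char_map : forall e, 'rV[R]_(cell_dim e) -> K;
  cw_hausdorff : hausdorff_space K;
  char_map_continuous : forall e,
    {within cube (cell_dim e), continuous (@char_map e)};
  char_map_inj : forall e x y,
    open_cube (cell_dim e) x -> open_cube (cell_dim e) y ->
    @char_map e x = @char_map e y -> x = y;
  char_map_open : forall e (V : set 'rV[R]_(cell_dim e)), open V ->
    exists2 W, open W &
      @char_map e @` (open_cube (cell_dim e) `&` V)
      = W `&` open_cell (@char_map e);
  cell_cover : forall x, exists e, open_cell (@char_map e) x;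
  cell_disjoint : forall e e' x,
    open_cell (@char_map e) x -> open_cell (@char_map e') x -> e = e';
  closure_finite : forall e, exists F : set cell,
    [/\ finite_set F, forall e', F e' -> (cell_dim e' < cell_dim e)%N &
        @char_map e @` cube_boundary (cell_dim e)
          `<=` \bigcup_(e' in F) open_cell (@char_map e')];
  cw_weak_topology : forall A : set K,
    (forall e, closed (cube (cell_dim e) `&` @char_map e @^-1` A)) ->
    closed A
}.

Arguments char_map {R K} {c} e x.

Definition subcomplex (R : realType) (K : topologicalType)
    (S : CW_structure R K) (G : set K) : Prop :=
  closed G /\
  exists C : set (cell S), G = \bigcup_(e in C) open_cell (char_map e).

(** ** C^0-dense weak homotopy equivalences *)

Section C0Dense.
Context {R : realType} {n m : nat} {N : manifold R n} {M : manifold R m}.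

Definition compatible_distance (X : topologicalType) (d : X -> X -> R) : Prop :=
  [/\ forall x y, 0 <= d x y,
      forall x y, d x y = 0 <-> x = y,
      forall x y, d x y = d y x,
      forall x y z, d x z <= d x y + d y z &
      forall x (A : set X),
        nbhs x A <-> exists2 e : R, 0 < e & [set y | d x y < e] `<=` A].

Variables (ref : N -> M) (d : M -> M -> R).

Definition C0_nbhd (phi : Emb ref) (eps : R) : set (Emb ref) :=
  [set psi | forall x : N, inf [set d (psi x) y | y in range phi] < eps].

Definition C0_dense_weak_equivalence (E0 E1 : set (Emb ref)) : Prop :=
  forall eps : R, 0 < eps ->
  forall (K : topologicalType) (S : CW_structure R K) (G : set K),
    compact [set: K] -> subcomplex S G ->
  forall phi : K -> Emb ref, continuous phi ->
    (forall k, E1 (phi k)) -> (forall k, G k -> E0 (phi k)) ->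
  exists Phi : K * R -> Emb ref,
    {within [set: K] `*` `[0, 1]%classic, continuous Phi} /\
    (forall k (t : R), 0 <= t <= 1 -> E1 (Phi (k, t))) /\
    [/\ forall k, Phi (k, 0) = phi k,
        forall k (t : R), G k -> 0 <= t <= 1 -> Phi (k, t) = phi k,
        forall k, E0 (Phi (k, 1)) &
        forall k (t : R), 0 <= t <= 1 -> C0_nbhd (phi k) eps (Phi (k, t))].

End C0Dense.

(* Main.v *)
Require Import Defs.
From HB Require Import structures.
From mathcomp Require Import all_boot all_order all_algebra.
From mathcomp Require Import all_classical all_reals all_analysis.
From mathcomp Require Import ring lra.

Set Implicit Arguments.
Unset Strict Implicit.
Unset Printing Implicit Defensive.

Import Order.TTheory GRing.Theory Num.Theory numFieldNormedType.Exports.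

Local Open Scope classical_set_scope.
Local Open Scope ring_scope.

(** Write U_phi(r) for the C0-neighborhood of phi of radius r. The argument uses
that U_phi(a + b) contains U_psi(b) for every psi in U_phi(a) (C0_nbhd_trans) and
that, for psi close to phi in the Whitney topology, psi lies in U_phi(r) and phi
lies in U_psi(r) (C0_nbhd_near). The latter holds because N is compact: uniform
closeness of maps follows from closeness in finitely many charts, on compact sets
that cover N.

Homotopy theory. If a subset A0 of a subset A1 of a space is weakly equivalent to
it, a map of a ball to A1, with a homotopy in A1 given on the sphere and ending
in A0, extends to a homotopy of the whole ball in A1 that ends in A0
(ball_extension). This expresses that the relative homotopy groups vanish.
Two maps g and g' of a ball that agree on the sphere form a map of two
balls glued along the sphere, and collapsing the center of the second one gives a
spheroid based at g' 0 (double). Injectivity on homotopy groups shows that a map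
to A1 with values in A0 on the sphere can be replaced on the interior by a map g'
to A0 (filling). By surjectivity the double of g and g' is homotopic to a
spheroid of A0, and grafting that spheroid onto g' gives a map to A0 that is
homotopic to g (homotopic_graft, homotopic_into).

Control. Let f be a map of a cube to E1 and let eps be positive. The claim is
that a homotopy of f on the boundary of the cube, ending in E0 and of size delta,
extends to one on the cube of size eps, for some delta depending on f and eps
(extendable_cube). If the values of f lie in a small neighborhood of a single
embedding, this is the homotopy extension above, applied in that neighborhood
(extendable_small). The claim for a cube follows from the claims for its two
halves and for the middle face between them: given the sizes allowed on the
boundaries of the halves, the homotopy is first extended over the middle face
with at most these sizes (extendable_split). The middle face has smaller
dimension, so that the claim is known for it for every size. As the cube is
compact, sufficiently fine boxes satisfy the claim, and undoing the halvings
proves it for the cube (extendable_boxes).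

Cells. A compact CW complex has finitely many cells (finite_cells). The homotopy
is constant on the subcomplex and is extended over the remaining cells in the
order of dimension, each time asking for a smaller size on the cells already
treated (controlled_homotopy_cells). *)

(** * Continuity on subsets *)

Section WithinContinuity.

Lemma within_comp (X Y Z : topologicalType) (D : set X) (E : set Y)
    (f : X -> Y) (g : Y -> Z) :
  {within D, continuous f} -> {within E, continuous g} ->
  (forall x, D x -> E (f x)) -> {within D, continuous (fun x => g (f x))}.
Proof.
move=> /subspace_continuousP cf /subspace_continuousP cg fDE.
apply/subspace_continuousP => x Dx.
move=> V /(cg _ (fDE _ Dx)) EV; have fV := cf _ Dx _ EV.
rewrite /nbhs /= /fmap /= /within /= in fV *.
by near=> y => Dy; apply: (near fV y) => //; exact: fDE.
Unshelve. all: by end_near.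
Qed.

Lemma within_compT (X Y Z : topologicalType) (D : set X) (E : set Y)
    (f : X -> Y) (g : Y -> Z) :
  continuous f -> {within E, continuous g} ->
  (forall x, D x -> E (f x)) -> {within D, continuous (fun x => g (f x))}.
Proof. by move=> cf; apply: within_comp; exact: continuous_subspaceT. Qed.

Lemma eq_within (X Y : topologicalType) (D : set X) (f g : X -> Y) :
  (forall x, D x -> f x = g x) ->
  {within D, continuous f} -> {within D, continuous g}.
Proof.
by move=> fg; apply: subspace_eq_continuous => x; rewrite inE; exact: fg.
Qed.

Lemma within_pair (X Y Z : topologicalType) (D : set X)
    (f : X -> Y) (g : X -> Z) :
  {within D, continuous f} -> {within D, continuous g} ->
  {within D, continuous (fun x => (f x, g x))}.
Proof.
move=> /subspace_continuousP cf /subspace_continuousP cg.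
apply/subspace_continuousP => x Dx.
by apply: cvg_pair; [exact: cf|exact: cg].
Qed.

(** Continuity at a point of [D] is tested on those of [A] and [B] that contain
the point, since near it the other one is absent. *)
Lemma within_paste (X Y : topologicalType) (D A B : set X) (f g h : X -> Y) :
  closed A -> closed B -> D `<=` A `|` B ->
  {within D `&` A, continuous f} -> {within D `&` B, continuous g} ->
  (forall x, D x -> A x -> h x = f x) -> (forall x, D x -> B x -> h x = g x) ->
  {within D, continuous h}.
Proof.
move=> Acl Bcl DAB cf cg hf hg; apply/subspace_continuousP => x Dx V Vhx.
suff H (C : set X) (k : X -> Y) : closed C -> {within D `&` C, continuous k} ->
    (forall y, D y -> C y -> h y = k y) ->
    \forall y \near x, D y -> C y -> V (h y).
  have hV : nbhs x [set y | D y -> V (h y)].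
    apply: filterS2 (H _ _ Acl cf hf) (H _ _ Bcl cg hg) => y yA yB Dy.
    by case: (DAB y Dy) => [/yA|/yB]; exact.
  exact: hV.
move=> Ccl /subspace_continuousP ck hk.
have [Cx|nCx] := pselect (C x); last first.
  have : nbhs x (~` C) by apply: open_nbhs_nbhs; split => //; exact: closed_openC.
  by apply: filterS => y nCy _ /nCy.
have Vkx : nbhs (k x) V by rewrite -hk.
have kV : nbhs x [set y | (D `&` C) y -> V (k y)].
  exact: (ck x (conj Dx Cx)).
by apply: filterS kV => y Vy Dy Cy; rewrite hk //; exact: Vy.
Qed.

(** A continuous map from a compact set onto a subset of a Hausdorff space is a
quotient map onto its image: closed sets of the source are compact, hence have
compact, hence closed, images. *)
Lemma within_quotient (X Y Z : topologicalType) (C : set X) (p : X -> Y)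
    (h : Y -> Z) :
  hausdorff_space Y -> compact C -> {within C, continuous p} ->
  {within C, continuous (fun x => h (p x))} -> {within p @` C, continuous h}.
Proof.
move=> hY Cco cp chp; apply/subspace_continuousP => _ [c Cc <-] V.
rewrite nbhsE => -[W [Wo Whc] WV].
have clW := (continuous_closedP _).1 chp _ (open_closedC Wo).
have [F Fcl FE] := (closed_subspaceP _ _).1 clW.
have Pco : compact (p @` (C `&` F)).
  apply: continuous_compact; last exact: compact_closedI.
  by apply: continuous_subspaceW cp => ? [].
have Pcl := compact_closed hY Pco.
have : nbhs (p c) (~` (p @` (C `&` F))).
  apply: open_nbhs_nbhs; split; first exact: closed_openC.
  case=> c' [Cc' Fc'] pc'.
  have : (F `&` C) c' by [].
  rewrite FE => -[nW _]; apply: nW.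
  by change (W (h (p c'))); rewrite pc'.
apply: filterS => y nP [c' Cc' yE]; rewrite -yE in nP *.
apply: WV; apply: contrapT => nW; apply: nP; exists c' => //; split=> //.
by have : ((fun x => h (p x)) @^-1` (~` W) `&` C) c' by []; rewrite -FE => -[].
Qed.

End WithinContinuity.

(** * Row vectors with the supremum norm *)

Section RowVectors.
Context {R : realType}.

Lemma continuousZf (X : topologicalType) n (k : X -> R) (f : X -> 'rV[R]_n) :
  continuous k -> continuous f -> continuous (fun x => k x *: f x).
Proof. by move=> ck cf x; apply: cvgZ; [exact: ck|exact: cf]. Qed.

Lemma continuousDf (X : topologicalType) (V : normedModType R) (f g : X -> V) :
  continuous f -> continuous g -> continuous (fun x => f x + g x).
Proof. by move=> cf cg x; apply: cvgD; [exact: cf|exact: cg]. Qed.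

Lemma continuousBf (X : topologicalType) (V : normedModType R) (f g : X -> V) :
  continuous f -> continuous g -> continuous (fun x => f x - g x).
Proof. by move=> cf cg x; apply: cvgB; [exact: cf|exact: cg]. Qed.

Lemma continuousMf (X : topologicalType) (f g : X -> R) :
  continuous f -> continuous g -> continuous (fun x => f x * g x).
Proof. by move=> cf cg x; apply: cvgM; [exact: cf|exact: cg]. Qed.

Lemma continuous_normf (X : topologicalType) n (f : X -> 'rV[R]_n) :
  continuous f -> continuous (fun x => `|f x|).
Proof. by move=> cf x; apply: cvg_norm; exact: cf. Qed.

Lemma continuous_maxf (X : topologicalType) (f g : X -> R) :
  continuous f -> continuous g -> continuous (fun x => Num.max (f x) (g x)).
Proof. by move=> cf cg x; apply: continuous_max; [exact: cf|exact: cg]. Qed.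

Lemma continuous_inv_maxf (X : topologicalType) (f : X -> R) (c : R) :
  0 < c -> continuous f -> continuous (fun x => (Num.max (f x) c)^-1).
Proof.
move=> c0 cf x; apply: cvgV; first by rewrite gt_eqF // lt_max c0 orbT.
by apply: (@continuous_maxf X f (fun=> c)) => // y; exact: cvg_cst.
Qed.

Lemma continuous_pair (X Y Z : topologicalType) (f : X -> Y) (g : X -> Z) :
  continuous f -> continuous g -> continuous (fun x => (f x, g x)).
Proof. by move=> cf cg x; apply: cvg_pair; [exact: cf|exact: cg]. Qed.

Lemma continuous_fstT (X Y : topologicalType) : continuous (fun z : X * Y => z.1).
Proof. by move=> z; exact: cvg_fst. Qed.

Lemma continuous_sndT (X Y : topologicalType) : continuous (fun z : X * Y => z.2).
Proof. by move=> z; exact: cvg_snd. Qed.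

Lemma continuous_idT (X : topologicalType) : continuous (fun z : X => z).
Proof. by move=> z. Qed.

Lemma continuous_cstT (X Y : topologicalType) (y : Y) : continuous (fun _ : X => y).
Proof. by move=> z; exact: cvg_cst. Qed.

Lemma continuous_row (X : topologicalType) n (f : X -> 'I_n -> R) :
  (forall j, continuous (fun x => f x j)) -> continuous (fun x => \row_j f x j).
Proof.
move=> cf x V [P PV sub].
apply: filterS (_ : nbhs x [set y | forall i j, P i j (f y j)]).
  by move=> y Py; apply: sub => i j; rewrite !mxE.
have H i : nbhs x [set y | forall j, P i j (f y j)].
  apply: filter_forall => j; apply: cf; have := PV i j.
  by rewrite !mxE.
by apply: filter_forall => i; exact: H.
Qed.

Lemma continuous_coordf (X : topologicalType) n (f : X -> 'rV[R]_n) j :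
  continuous f -> continuous (fun x => f x 0 j).
Proof.
move=> cf x; apply: (continuous_comp (f := f) (g := fun M : 'rV[R]_n => M 0 j)).
  exact: cf.
exact: coord_continuous.
Qed.

Lemma rV_norm_le n (x : 'rV[R]_n) (c : R) : 0 <= c ->
  `|x| <= c <-> forall i, `|x 0 i| <= c.
Proof.
move=> c0; rewrite [`|x|]mx_normrE; split.
  move=> /bigmax_leP[_ h] i; exact: (h (0, i)).
by move=> h; apply/bigmax_leP; split=> // -[i j] _; rewrite ord1; exact: h.
Qed.

Lemma rV_norm_eq n (x : 'rV[R]_n) (c : R) : 0 < c -> `|x| <= c ->
  `|x| = c <-> exists i, `|x 0 i| = c.
Proof.
move=> c0 xc; split=> [xE|[i xi]].
  have : mx_norm x != 0 by rewrite -[mx_norm x]/(`|x|) xE gt_eqF.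
  move=> /mx_norm_neq0 [[i j]]; rewrite -[mx_norm x]/(`|x|) xE /= ord1 => h.
  by exists j.
apply/eqP; rewrite eq_le xc /= -xi.
by have /rV_norm_le := lexx `|x|; apply.
Qed.

End RowVectors.

(* The proofs of continuity follow the syntax of the function: trying the lemmas
one after the other would unfold real numbers and matrices. *)
Ltac cont := lazymatch goal with |- forall x, continuous_at x ?f =>
  lazymatch f with
  | fun z => z => exact: continuous_idT
  | fst => exact: continuous_fstT
  | snd => exact: continuous_sndT
  | fun z => fst z => exact: continuous_fstT
  | fun z => snd z => exact: continuous_sndT
  | fun z => (_, _) => apply: continuous_pair; cont
  | fun z => GRing.scale _ _ => apply: continuousZf; cont
  | fun z => GRing.add _ (GRing.opp _) => apply: continuousBf; cont
  | fun z => GRing.add _ _ => apply: continuousDf; cont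
  | fun z => GRing.inv (Order.max _ _) =>
      apply: continuous_inv_maxf; [by lra|cont]
  | fun z => GRing.mul _ _ => apply: continuousMf; cont
  | fun z => Order.max _ _ => apply: continuous_maxf; cont
  | fun z => Num.norm _ => apply: continuous_normf; cont
  | fun z => fun_of_matrix _ _ _ => apply: continuous_coordf; cont
  | Num.norm => exact: norm_continuous
  | GRing.scale ?k =>
      exact: (continuousZf (@continuous_cstT _ _ k) (@continuous_idT _))
  | GRing.mul ?k =>
      exact: (continuousMf (@continuous_cstT _ _ k) (@continuous_idT _))
  | _ => first [assumption | exact: continuous_cstT]
  end end.

(** * Homotopies of maps of the ball relative to the sphere *)

Section BallHomotopies.
Context {R : realType}.

Definition I01 : set R := [set t | 0 <= t <= 1].
Definition unit_ball n : set 'rV[R]_n := [set x | `|x| <= 1].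

Lemma I01_0 : I01 0. Proof. by rewrite /I01 /= lexx ler01. Qed.
Lemma I01_1 : I01 1. Proof. by rewrite /I01 /= lexx ler01. Qed.

(** The inverse of the norm, cut off near 0 so as to be continuous: it is used to
push points radially at norm at least 1/2. *)
Definition inv_norm n (x : 'rV[R]_n) : R := (Num.max `|x| (1/2))^-1.

Lemma inv_norm_in n (x : 'rV[R]_n) : `|x| <= 1/2 -> inv_norm x = 2.
Proof. by move=> h; rewrite /inv_norm max_r // invf_div divr1. Qed.

Lemma inv_norm_out n (x : 'rV[R]_n) : 1/2 <= `|x| -> inv_norm x * `|x| = 1.
Proof. by move=> h; rewrite /inv_norm max_l // mulVf // gt_eqF //; lra. Qed.

Lemma inv_norm1 n (x : 'rV[R]_n) : `|x| = 1 -> inv_norm x = 1.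
Proof. by move=> h; rewrite /inv_norm h max_l ?invr1 //; lra. Qed.

Lemma inv_norm_itv n (x : 'rV[R]_n) : `|x| <= 1 -> 1 <= inv_norm x <= 2.
Proof.
move=> h; have [/inv_norm_in ->|h'] := leP `|x| (1/2); first by lra.
have := inv_norm_out (ltW h'); nra.
Qed.

Lemma inv_norm_le n (x : 'rV[R]_n) : inv_norm x * `|x| <= 1.
Proof.
have [h|h] := leP `|x| (1/2); first by rewrite inv_norm_in //; lra.
by rewrite inv_norm_out ?(ltW h).
Qed.

Lemma normZ_ge0 n (k : R) (x : 'rV[R]_n) : 0 <= k -> `|k *: x| = k * `|x|.
Proof. by move=> k0; rewrite normrZ ger0_norm. Qed.

Lemma closed_le_fun (X : topologicalType) (f : X -> R) c :
  continuous f -> closed [set x | f x <= c].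
Proof. by move=> cf; apply: (closed_comp _ (@closed_le R c)) => ? _; exact: cf. Qed.

Lemma closed_ge_fun (X : topologicalType) (f : X -> R) c :
  continuous f -> closed [set x | c <= f x].
Proof. by move=> cf; apply: (closed_comp _ (@closed_ge R c)) => ? _; exact: cf. Qed.

Context {T : topologicalType}.

Definition homotopic_rel (A : set T) n (g g' : 'rV[R]_n -> T) : Prop :=
  exists H : R * 'rV[R]_n -> T,
  [/\ {within I01 `*` @unit_ball n, continuous H},
      forall z, (I01 `*` @unit_ball n) z -> A (H z),
      forall x, unit_ball x -> H (0, x) = g x,
      forall x, unit_ball x -> H (1, x) = g' x &
      forall t x, I01 t -> `|x| = 1 -> H (t, x) = g x].

Lemma homotopic_rel_sphere (A : set T) n (g g' : 'rV[R]_n -> T) :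
  homotopic_rel A g g' -> forall x, `|x| = 1 -> g' x = g x.
Proof.
case=> H [_ _ _ H1 Hr] x x1; rewrite -H1 ?Hr //; first exact: I01_1.
by rewrite /unit_ball /= x1.
Qed.

Lemma homotopic_rel_trans (A : set T) n (g1 g2 g3 : 'rV[R]_n -> T) :
  homotopic_rel A g1 g2 -> homotopic_rel A g2 g3 -> homotopic_rel A g1 g3.
Proof.
move=> h12 [K [Kc KA K0 K1 Kr]]; have g21 := homotopic_rel_sphere h12.
move: h12 => [H [Hc HA H0 H1 Hr]].
exists (fun z => if z.1 <= 1/2 then H (2 * z.1, z.2) else K (2 * z.1 - 1, z.2)).
split.
- apply: (@within_paste _ _ _ [set z : R * 'rV[R]_n | z.1 <= 1/2]
    [set z : R * 'rV[R]_n | 1/2 <= z.1]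
    (fun z => H (2 * z.1, z.2)) (fun z => K (2 * z.1 - 1, z.2))).
  + by apply: closed_le_fun; cont.
  + by apply: closed_ge_fun; cont.
  + by move=> z _ /=; have [?|/ltW ?] := leP z.1 (1/2); [left|right].
  + apply: (within_compT _ Hc); first by cont.
    by move=> [t x] [[/andP[/= t0 t1] xb] /= t2]; split=> //=; rewrite /I01 /=; lra.
  + apply: (within_compT _ Kc); first by cont.
    by move=> [t x] [[/andP[/= t0 t1] xb] /= t2]; split=> //=; rewrite /I01 /=; lra.
  + by move=> z _ /= ->.
  + move=> [t x] [_ xb] /= t2; case: ifP => // t2'.
    have -> : t = 1/2 by lra.
    rewrite (_ : 2 * (1/2) - 1 = 0 :> R); last by lra.
    by rewrite (_ : 2 * (1/2) = 1 :> R) ?H1 ?K0 //; lra.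
- move=> [t x] [/andP[/= t0 t1] xb]; case: ifPn => t2.
    by apply: HA; split=> //=; rewrite /I01 /=; lra.
  by apply: KA; split=> //=; rewrite /I01 /=; lra.
- move=> x xb /=; rewrite ifT; last by lra.
  by rewrite mulr0 H0.
- move=> x xb /=; rewrite ifF; last by apply/negbTE; rewrite -ltNge; lra.
  by rewrite (_ : 2 * 1 - 1 = 1 :> R) ?K1 //; lra.
- move=> t x /andP[t0 t1] x1 /=; case: ifPn => t2.
    by rewrite Hr // /I01 /=; lra.
  by rewrite Kr ?g21 // /I01 /=; lra.
Qed.

Lemma homotopic_rel_move (A : set T) n (g : 'rV[R]_n -> T)
    (s : R * 'rV[R]_n -> 'rV[R]_n) (g0 g1 : 'rV[R]_n -> T) :
  {within @unit_ball n, continuous g} -> (forall x, unit_ball x -> A (g x)) ->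
  continuous s -> (forall t x, I01 t -> unit_ball x -> unit_ball (s (t, x))) ->
  (forall x, unit_ball x -> g (s (0, x)) = g0 x) ->
  (forall x, unit_ball x -> g (s (1, x)) = g1 x) ->
  (forall t x, I01 t -> `|x| = 1 -> g (s (t, x)) = g0 x) ->
  homotopic_rel A g0 g1.
Proof.
move=> gc gA sc sb s0 s1 sr; exists (fun z => g (s z)); split => //.
  by apply: (within_compT sc gc) => -[t x] [/= ? ?]; exact: sb.
by move=> [t x] [/= ? ?]; exact/gA/sb.
Qed.

(** The ball of radius 2 is the union of two copies of the unit ball glued along
the unit sphere: its points outside the unit ball are reflected radially. *)
Definition double n (g g' : 'rV[R]_n -> T) (y : 'rV[R]_n) : T :=
  if `|y| <= 1 then g y else g' ((2 * (Num.max `|y| 1)^-1 - 1) *: y).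

Lemma double_out n (g g' : 'rV[R]_n -> T) (y : 'rV[R]_n) :
  (forall x, `|x| = 1 -> g x = g' x) -> 1 <= `|y| ->
  double g g' y = g' ((2 * (Num.max `|y| 1)^-1 - 1) *: y).
Proof.
move=> gg' y1; rewrite /double; case: ifPn => // y1'.
have yE : `|y| = 1 by lra.
rewrite yE max_l // invr1 gg' // (_ : 2 * 1 - 1 = 1 :> R) ?scale1r //; lra.
Qed.

Lemma fold_norm n (y : 'rV[R]_n) : `|y| <= 2 ->
  `|(2 * (Num.max `|y| 1)^-1 - 1) *: y| = Num.min `|y| (2 - `|y|).
Proof.
move=> y2; have [y1|y1] := leP `|y| 1.
  rewrite invr1 (_ : 2 * 1 - 1 = 1 :> R) ?scale1r ?min_l //; lra.
have h : `|y|^-1 * `|y| = 1 by rewrite mulVf // gt_eqF //; lra.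
have h0 : 0 < `|y|^-1 by rewrite invr_gt0; lra.
rewrite min_r ?normZ_ge0; [|nra|lra].
by rewrite mulrBl -mulrA h; lra.
Qed.

Lemma fold_ball n (y : 'rV[R]_n) : `|y| <= 2 ->
  unit_ball ((2 * (Num.max `|y| 1)^-1 - 1) *: y).
Proof.
by move=> y2; rewrite /unit_ball /= fold_norm // ge_min; apply/orP; lra.
Qed.

Lemma double_mem (A : set T) n (g g' : 'rV[R]_n -> T) (y : 'rV[R]_n) :
  (forall x, unit_ball x -> A (g x)) -> (forall x, unit_ball x -> A (g' x)) ->
  `|y| <= 2 -> A (double g g' y).
Proof.
move=> gA gA' y2; rewrite /double; case: ifPn => y1; first exact: gA.
exact/gA'/fold_ball.
Qed.

Lemma within_double (P : topologicalType) (S : set P) n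
    (g g' : P * 'rV[R]_n -> T) :
  {within S `*` @unit_ball n, continuous g} ->
  {within S `*` @unit_ball n, continuous g'} ->
  (forall p x, S p -> `|x| = 1 -> g (p, x) = g' (p, x)) ->
  {within S `*` [set y : 'rV[R]_n | `|y| <= 2], continuous
     (fun z => double (fun y => g (z.1, y)) (fun y => g' (z.1, y)) z.2)}.
Proof.
move=> gc gc' gg'.
apply: (@within_paste _ _ _ [set z : P * 'rV[R]_n | `|z.2| <= 1]
  [set z : P * 'rV[R]_n | 1 <= `|z.2|]
  g (fun z => g' (z.1, (2 * (Num.max `|z.2| 1)^-1 - 1) *: z.2))).
- by apply: closed_le_fun; cont.
- by apply: closed_ge_fun; cont.
- by move=> z _ /=; have [?|/ltW ?] := leP `|z.2| 1; [left|right].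
- by apply: continuous_subspaceW gc => -[p y] [[]].
- apply: (within_compT _ gc'); first by cont.
  by move=> [p y] [[/= Sp y2] _]; split=> //=; exact: fold_ball.
- by move=> [p y] _ /= y1; rewrite /double y1.
- by move=> [p y] [/= Sp y2] y1; rewrite double_out // => x; exact: gg'.
Qed.

Lemma within_double1 n (g g' : 'rV[R]_n -> T) :
  {within @unit_ball n, continuous g} -> {within @unit_ball n, continuous g'} ->
  (forall x, `|x| = 1 -> g x = g' x) ->
  {within [set y : 'rV[R]_n | `|y| <= 2], continuous (double g g')}.
Proof.
move=> gc gc' gg'.
have gc2 : {within [set: R] `*` @unit_ball n, continuous (fun z => g z.2)}.
  by apply: (within_compT _ gc); [cont|move=> z []].
have gc2' : {within [set: R] `*` @unit_ball n, continuous (fun z => g' z.2)}.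
  by apply: (within_compT _ gc'); [cont|move=> z []].
have h := within_double gc2 gc2' (fun _ x _ => gg' x).
by apply: (within_compT (f := fun y : 'rV[R]_n => (0 : R, y)) _ h); first cont.
Qed.

End BallHomotopies.

(** * Changing a map of the ball by a spheroid *)

Section Grafting.
Context {R : realType} {T : topologicalType}.

Definition ball_map (A : set T) n (g : 'rV[R]_n -> T) : Prop :=
  {within @unit_ball R n, continuous g} /\ forall x, unit_ball x -> A (g x).

(** The action of the spheroid [s], based at [g 0], on the map [g]: the ball is
pinched along the sphere of radius 1/2, and the outer part is a ball with its
center blown up to that sphere. *)
Definition graft n (s g : 'rV[R]_n -> T) (x : 'rV[R]_n) : T :=
  if `|x| <= 1/2 then s (2 *: x) else g ((2 - inv_norm x) *: x).

Lemma graft_scale_norm n (x : 'rV[R]_n) : 1/2 <= `|x| ->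
  `|(2 - inv_norm x) *: x| = 2 * `|x| - 1.
Proof.
move=> x1; have h := inv_norm_out x1.
have : inv_norm x <= 2 by nra.
by move=> h'; rewrite normZ_ge0 ?mulrBl ?h //; lra.
Qed.

Lemma half_scale_norm n (x : 'rV[R]_n) : `|2 *: x| = 2 * `|x|.
Proof. by rewrite normZ_ge0 //; lra. Qed.

Lemma norm_half_graft n (x : 'rV[R]_n) : `|x| = 1/2 -> (2 - inv_norm x) *: x = 0.
Proof. by move=> h; rewrite inv_norm_in ?h ?subrr ?scale0r //; lra. Qed.

Lemma graft_sphere n (s g : 'rV[R]_n -> T) x :
  `|x| = 1 -> graft s g x = g x.
Proof.
move=> x1; rewrite /graft ifF; last by apply/negbTE; rewrite -ltNge x1; lra.
by rewrite inv_norm1 // (_ : 2 - 1 = 1) ?scale1r //; lra.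
Qed.

Lemma within_graft (P : topologicalType) (S : set P) n
    (s g : P * 'rV[R]_n -> T) :
  {within S `*` @unit_ball R n, continuous s} ->
  {within S `*` @unit_ball R n, continuous g} ->
  (forall p x, S p -> `|x| = 1 -> s (p, x) = g (p, 0)) ->
  {within S `*` @unit_ball R n, continuous
     (fun z => graft (fun x => s (z.1, x)) (fun x => g (z.1, x)) z.2)}.
Proof.
move=> sc gc sg.
apply: (@within_paste _ _ _ [set z : P * 'rV[R]_n | `|z.2| <= 1/2]
  [set z : P * 'rV[R]_n | 1/2 <= `|z.2|]
  (fun z => s (z.1, 2 *: z.2)) (fun z => g (z.1, (2 - inv_norm z.2) *: z.2))).
- by apply: closed_le_fun; cont.
- by apply: closed_ge_fun; cont.
- by move=> z _ /=; have [?|/ltW ?] := leP `|z.2| (1/2); [left|right].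
- apply: (within_compT _ sc); first by cont.
  move=> [p x] [[/= Sp x1] /= x2]; split=> //=.
  by rewrite /unit_ball /= half_scale_norm; lra.
- apply: (within_compT _ gc); first by rewrite /inv_norm; cont.
  move=> [p x] [[/= Sp x1] /= x2]; split=> //=.
  by rewrite /unit_ball /= in x1 *; rewrite graft_scale_norm //; lra.
- by move=> [p x] _ /= x1; rewrite /graft x1.
- move=> [p x] [/= Sp x1] x2; rewrite /graft; case: ifPn => // x2'.
  have xE : `|x| = 1/2 by lra.
  by rewrite norm_half_graft // sg // half_scale_norm; lra.
Qed.

Lemma graft_mem (A : set T) n (s g : 'rV[R]_n -> T) :
  (forall x, unit_ball x -> A (s x)) -> (forall x, unit_ball x -> A (g x)) ->
  forall x, unit_ball x -> A (graft s g x).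
Proof.
move=> sA gA x x1; rewrite /graft; case: ifPn => x2.
  by apply: sA; rewrite /unit_ball /= half_scale_norm; lra.
apply: gA; move: x1; rewrite /unit_ball /= => x1.
by rewrite graft_scale_norm; lra.
Qed.

(** Two maps that agree on the sphere differ by the spheroid [double]: replacing
that spheroid by a homotopic one changes the first map by a homotopy. The first
stage stretches the ball radially over the ball of radius 2 and back, along a
radius [r |-> min (4 r) (3 - 2 r)] at its end. *)
Lemma homotopic_graft (A : set T) n (g g' s : 'rV[R]_n -> T) :
  ball_map A g -> ball_map A g' -> (forall x, `|x| = 1 -> g x = g' x) ->
  homotopic_rel A (fun x => double g g' (2 *: x)) s ->
  homotopic_rel A g (graft s g').
Proof.
move=> [gc gA] [gc' gA'] gg' [H [Hc HA H0 H1 Hr]].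
have dc := within_double1 gc gc' gg'.
pose k (u : R) (x : 'rV[R]_n) := 1 - u + u * (3 * inv_norm x - 2).
have kn u x : I01 u -> unit_ball x -> `|k u x *: x| <= 2.
  rewrite /I01 /unit_ball /= => u01 x1; have xi := inv_norm_itv x1.
  have ui : u <= u * inv_norm x by nra.
  rewrite normZ_ge0 /k; last by lra.
  have [x2|/ltW x2] := leP `|x| (1/2).
    by rewrite inv_norm_in //; have := normr_ge0 x; nra.
  rewrite (_ : _ * `|x| = (1 - 3 * u) * `|x| + 3 * u * (inv_norm x * `|x|)).
    by rewrite inv_norm_out //; nra.
  by ring.
apply: (@homotopic_rel_trans _ _ _ _ _ (graft (fun x => double g g' (2 *: x)) g')).
  exists (fun z => double g g' (k z.1 z.2 *: z.2)); split.
  - apply: (within_compT _ dc); first by rewrite /k /inv_norm; cont.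
    by move=> [u x] [/= ? ?]; exact: kn.
  - by move=> [u x] [/= ? ?]; apply: double_mem => //; exact: kn.
  - move=> x x1; rewrite /k /= mul0r addr0 subr0 scale1r /double ifT //.
  - rewrite /unit_ball /= => x x1; rewrite /graft; case: ifPn => x2.
      rewrite scalerA; congr (double _ _ (_ *: _)).
      by rewrite /k inv_norm_in //; lra.
    have {}x2 : 1/2 <= `|x| by lra.
    have xi := inv_norm_out x2; have xb := inv_norm_itv x1.
    have kE : `|k 1 x *: x| = 3 - 2 * `|x|.
      rewrite normZ_ge0 /k; last by lra.
      by nra.
    rewrite double_out //; last by rewrite kE; lra.
    rewrite kE scalerA max_l; last by lra.
    congr (g' (_ *: _)); rewrite /k.
    have x0 : 0 < `|x| by lra.
    have -> : inv_norm x = `|x|^-1 by rewrite /inv_norm max_l.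
    have d0 : 3 - 2 * `|x| != 0 by rewrite gt_eqF //; lra.
    have x0' : `|x| != 0 by rewrite gt_eqF.
    field; by rewrite x0' d0.
  - move=> u x u01 x1; rewrite /k inv_norm1 // (_ : _ + _ = 1); last by lra.
    by rewrite scale1r /double x1 lexx.
exists (fun z => graft (fun x => H (z.1, x)) g' z.2).
have Hsph p x : I01 p -> `|x| = 1 -> H (p, x) = g' 0.
  move=> p01 x1; rewrite Hr // double_out ?half_scale_norm ?x1 //; last by lra.
  by rewrite max_l ?mulr1 ?mulfV ?subrr ?scale0r //; lra.
split.
- apply: (@within_graft _ _ _ H (fun z => g' z.2)) => //.
  by apply: (within_compT _ gc'); [cont|move=> z []].
- move=> [u x] [/= u01 x1]; apply: graft_mem => // y y1; exact: HA.
- move=> x; rewrite /unit_ball /graft /= => x1; case: ifPn => // x2.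
  by rewrite H0 // /unit_ball /= half_scale_norm; lra.
- move=> x; rewrite /unit_ball /graft /= => x1; case: ifPn => // x2.
  by rewrite H1 // /unit_ball /= half_scale_norm; lra.
- move=> u x u01 x1; rewrite !graft_sphere //.
Qed.

(** The converse: a homotopy from [g] to [g'] turns their double into the double
of [g'] with itself, which folds onto [g'] and contracts in the ball. *)
Lemma double_null (A : set T) n (g g' : 'rV[R]_n -> T) :
  ball_map A g' -> homotopic_rel A g g' ->
  homotopic_rel A (fun x => double g g' (2 *: x)) (fun=> g' 0).
Proof.
move=> [gc' gA'] hgg'; have gg' := homotopic_rel_sphere hgg'.
move: hgg' => [H [Hc HA H0 H1 Hr]].
have b2 x : unit_ball x -> `|2 *: x : 'rV[R]_n| <= 2.
  by rewrite /unit_ball /= half_scale_norm; lra.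
have Hs t x : I01 t -> `|x| = 1 -> H (t, x) = g' x.
  by move=> ? ?; rewrite Hr ?gg'.
have g'c2 : {within @I01 R `*` @unit_ball R n, continuous (fun z => g' z.2)}.
  by apply: (within_compT _ gc'); [cont|move=> z []].
have sph f x : (forall x, `|x| = 1 -> f x = g' x) -> `|x| = 1 ->
    double f g' (2 *: x) = g' 0.
  move=> fg x1; rewrite double_out ?half_scale_norm ?x1 //; last by lra.
  by rewrite max_l ?mulr1 ?mulfV ?subrr ?scale0r //; lra.
apply: (@homotopic_rel_trans _ _ _ _ _ (fun x => double g' g' (2 *: x))).
  exists (fun z => double (fun x => H (z.1, x)) g' (2 *: z.2)); split.
  - have h := within_double Hc g'c2 Hs.
    apply: (@within_compT _ _ _ _ _ (fun z : R * 'rV[R]_n => (z.1, 2 *: z.2))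
      (fun z => double (fun x => H (z.1, x)) g' z.2) _ h); first by cont.
    by move=> [t x] [/= ? ?]; split => //=; exact: b2.
  - move=> [t x] [/= ? ?]; apply: double_mem => //; last exact: b2.
    by move=> y ?; exact: HA.
  - by move=> x x1; rewrite /double /=; case: ifP => // ?; rewrite H0.
  - by move=> x x1; rewrite /double /=; case: ifP => // ?; rewrite H1.
  - move=> t x t01 x1 /=; rewrite !sph // => y y1; first by rewrite gg'.
    exact: Hs.
pose fold (x : 'rV[R]_n) := (2 * (Num.max `|x| 1)^-1 - 1) *: x.
apply: (@homotopic_rel_move _ _ _ _ g' (fun z => (1 - z.1) *: fold (2 *: z.2))) => //.
- by rewrite /fold; cont.
- move=> t x /andP[t0 t1] /b2 /fold_ball; rewrite /unit_ball /= => h.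
  by rewrite normZ_ge0 /fold; nra.
- move=> x x1 /=; rewrite subr0 scale1r /double; case: ifPn => // h.
  by rewrite /fold max_r // invr1 mulr1 (_ : 2 - 1 = 1) ?scale1r //; lra.
- by move=> x x1 /=; rewrite subrr scale0r.
- move=> t x t01 x1 /=; rewrite sph // /fold half_scale_norm x1 max_l; last by lra.
  by rewrite mulr1 mulfV // subrr !(scale0r, scaler0).
Qed.

Lemma null_double (A : set T) n (g g' : 'rV[R]_n -> T) :
  ball_map A g -> ball_map A g' -> (forall x, `|x| = 1 -> g x = g' x) ->
  homotopic_rel A (fun x => double g g' (2 *: x)) (fun=> g' 0) ->
  homotopic_rel A g g'.
Proof.
move=> gA gA' gg' /(homotopic_graft gA gA' gg') h; apply: homotopic_rel_trans h _.
case: gA' => gc' gA'.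
apply: (@homotopic_rel_move _ _ _ _ g'
  (fun z => (z.1 + (1 - z.1) * (2 - inv_norm z.2)) *: z.2)) => //.
- by rewrite /inv_norm; cont.
- move=> t x; rewrite /unit_ball /I01 /= => t01 x1.
  have := inv_norm_itv x1 => xi.
  have hn : 0 <= `|x| by [].
  rewrite normZ_ge0; last by nra.
  suff : t + (1 - t) * (2 - inv_norm x) <= 1 by nra.
  by nra.
- move=> x x1 /=; rewrite add0r subr0 mul1r /graft; case: ifPn => // x2.
  by rewrite inv_norm_in // subrr scale0r.
- by move=> x x1 /=; rewrite subrr mul0r addr0 scale1r.
- move=> t x t01 x1; rewrite graft_sphere //= inv_norm1 //.
  rewrite (_ : t + (1 - t) * (2 - 1) = 1); last by lra.
  by rewrite scale1r.
Qed.

End Grafting.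

(** * Inserting a coordinate *)

Section InsertCoordinate.
Context {R : realType}.

Definition insert_coord q (i : 'I_q.+1) (v : R) (x : 'rV[R]_q) : 'rV[R]_q.+1 :=
  \row_j oapp (fun k => x 0 k) v (unlift i j).

Definition remove_coord q (i : 'I_q.+1) (z : 'rV[R]_q.+1) : 'rV[R]_q :=
  \row_k z 0 (lift i k).

Lemma insert_at q (i : 'I_q.+1) v x : insert_coord i v x 0 i = v.
Proof. by rewrite mxE unlift_none. Qed.

Lemma insert_lift q (i : 'I_q.+1) v x k : insert_coord i v x 0 (lift i k) = x 0 k.
Proof. by rewrite mxE liftK. Qed.

Lemma insertK q (i : 'I_q.+1) v : cancel (insert_coord i v) (remove_coord i).
Proof. by move=> x; apply/rowP => k; rewrite mxE insert_lift. Qed.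

Lemma removeK q (i : 'I_q.+1) (z : 'rV[R]_q.+1) :
  insert_coord i (z 0 i) (remove_coord i z) = z.
Proof.
apply/rowP => j; case: (unliftP i j) => [k ->|->]; last by rewrite insert_at.
by rewrite insert_lift mxE.
Qed.

Lemma continuous_insert (X : topologicalType) q (i : 'I_q.+1)
    (v : X -> R) (f : X -> 'rV[R]_q) :
  continuous v -> continuous f -> continuous (fun x => insert_coord i (v x) (f x)).
Proof.
move=> cv cf; apply: continuous_row => j; case: (unlift i j) => [k|] //=.
exact: continuous_coordf.
Qed.

Lemma continuous_remove (X : topologicalType) q (i : 'I_q.+1)
    (f : X -> 'rV[R]_q.+1) :
  continuous f -> continuous (fun x => remove_coord i (f x)).
Proof. by move=> cf; apply: continuous_row => j; exact: continuous_coordf. Qed.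

Lemma insert_forall q (i : 'I_q.+1) (P : R -> Prop) v x :
  (forall j, P (insert_coord i v x 0 j)) <-> P v /\ forall k, P (x 0 k).
Proof.
split=> [h|[hv hx] j].
  by split=> [|k]; [have := h i|have := h (lift i k)];
    rewrite ?insert_at ?insert_lift.
by case: (unliftP i j) => [k ->|->]; rewrite ?insert_at ?insert_lift.
Qed.

Lemma insert_exists q (i : 'I_q.+1) (P : R -> Prop) v x :
  (exists j, P (insert_coord i v x 0 j)) <-> P v \/ exists k, P (x 0 k).
Proof.
split=> [[j]|[hv|[k hk]]].
- case: (unliftP i j) => [k ->|->]; rewrite ?insert_at ?insert_lift.
    by right; exists k.
  by left.
- by exists i; rewrite insert_at.
- by exists (lift i k); rewrite insert_lift.
Qed.

End InsertCoordinate.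

(** * Compression into the smaller set *)

Section Compression.
Context {R : realType} {T : topologicalType}.

(** Weak equivalence of an inclusion. Injectivity on homotopy groups amounts to a
trivial kernel, except in dimension 0, where a map of the ball is a point and a
homotopy to the constant map is a path to [x0]. *)
Definition ball_equivalence (A0 A1 : set T) : Prop :=
  [/\ A0 `<=` A1, A1 !=set0 -> A0 !=set0,
      forall n (s : 'rV[R]_n -> T) x0, ball_map A0 s -> A0 x0 ->
        (forall x, `|x| = 1 -> s x = x0) ->
        homotopic_rel A1 s (fun=> x0) -> homotopic_rel A0 s (fun=> x0) &
      forall n (s : 'rV[R]_n -> T) x0, ball_map A1 s -> A0 x0 ->
        (forall x, `|x| = 1 -> s x = x0) ->
        exists2 s', ball_map A0 s' & homotopic_rel A1 s s'].

Lemma ball_map_sub (A0 A1 : set T) n (s : 'rV[R]_n -> T) :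
  A0 `<=` A1 -> ball_map A0 s -> ball_map A1 s.
Proof. by move=> sub [sc sA]; split=> // x /sA /sub. Qed.

Lemma ball_map_double (A : set T) n (g g' : 'rV[R]_n -> T) :
  ball_map A g -> ball_map A g' -> (forall x, `|x| = 1 -> g x = g' x) ->
  ball_map A (fun x => double g g' (2 *: x)).
Proof.
move=> [gc gA] [gc' gA'] gg'.
have b2 x : unit_ball x -> `|2 *: x : 'rV[R]_n| <= 2.
  by rewrite /unit_ball /= half_scale_norm; lra.
split; last by move=> x x1; apply: double_mem => //; exact: b2.
apply: (within_compT (f := fun x : 'rV[R]_n => 2 *: x) _
  (within_double1 gc gc' gg')) => //.
by apply: continuousZf; cont.
Qed.

Lemma double_sphere n (g g' : 'rV[R]_n -> T) :
  (forall x, `|x| = 1 -> g x = g' x) ->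
  forall x, `|x| = 1 -> double g g' (2 *: x) = g' 0.
Proof.
move=> gg' x x1; rewrite double_out ?half_scale_norm ?x1 //; last by lra.
by rewrite max_l ?mulr1 ?mulfV ?subrr ?scale0r //; lra.
Qed.

Lemma unit_ball0 n : unit_ball (0 : 'rV[R]_n).
Proof. by rewrite /unit_ball /= normr0. Qed.

Lemma compact_unit_ball n : compact (@unit_ball R n).
Proof.
apply: bounded_closed_compact; last first.
  by apply: closed_le_fun; exact: norm_continuous.
by exists 1; split => // M M1 x /le_trans; apply; exact: ltW.
Qed.

(** Injectivity on homotopy groups, for maps that agree on the sphere without
being constant there: their double is the spheroid to which it applies. *)
Lemma homotopic_rel_descent (A0 A1 : set T) n (g g' : 'rV[R]_n -> T) :
  ball_equivalence A0 A1 -> ball_map A0 g -> ball_map A0 g' ->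
  homotopic_rel A1 g g' -> homotopic_rel A0 g g'.
Proof.
move=> [A01 _ inj _] gA gA' h.
have gg' x : `|x| = 1 -> g x = g' x by move=> x1; rewrite (homotopic_rel_sphere h).
apply: null_double => //; apply: inj.
- exact: ball_map_double.
- by apply: gA'.2; exact: unit_ball0.
- exact: double_sphere.
- by apply: double_null => //; exact: ball_map_sub gA'.
Qed.

(** Surjectivity on homotopy groups, applied to the double of [g] and [g']. *)
Lemma homotopic_into (A0 A1 : set T) n (g g' : 'rV[R]_n -> T) :
  ball_equivalence A0 A1 -> ball_map A1 g -> ball_map A0 g' ->
  (forall x, `|x| = 1 -> g x = g' x) ->
  exists2 g1, homotopic_rel A1 g g1 & forall x, unit_ball x -> A0 (g1 x).
Proof.
move=> [A01 _ _ surj] gA gA' gg'; have gA1' := ball_map_sub A01 gA'.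
have [] := surj _ _ (g' 0) (ball_map_double gA gA1' gg').
- by apply: gA'.2; exact: unit_ball0.
- exact: double_sphere.
move=> s [sc sA] hs; exists (graft s g'); first exact: homotopic_graft.
by apply: graft_mem => //; exact: gA'.2.
Qed.

(** Central projection from the point (-1, 0) maps the bottom of the cylinder
onto the rest of its boundary, and sweeps out the cylinder by segments. The
restrictions of [g] to the bottom and to its projection are homotopic along
these segments in [A1], hence in [A0]; spreading a homotopy in [A0] over the
segments fills the cylinder. *)
Lemma filling_cylinder (A0 A1 : set T) n (g : R * 'rV[R]_n -> T) :
  ball_equivalence A0 A1 ->
  {within @I01 R `*` @unit_ball R n, continuous g} ->
  (forall z, (@I01 R `*` @unit_ball R n) z -> A1 (g z)) ->
  (forall t x, I01 t -> unit_ball x -> [\/ t = 0, t = 1 | `|x| = 1] ->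
    A0 (g (t, x))) ->
  exists g' : R * 'rV[R]_n -> T,
    [/\ {within @I01 R `*` @unit_ball R n, continuous g'},
        forall z, (@I01 R `*` @unit_ball R n) z -> A0 (g' z) &
        forall t x, I01 t -> unit_ball x -> [\/ t = 0, t = 1 | `|x| = 1] ->
          g' (t, x) = g (t, x)].
Proof.
move=> E gc gA1 gA0.
(* p (t, x) runs from the point (0, x) of the bottom to its projection *)
pose mu (z : R * 'rV[R]_n) := 1 + z.1 * (inv_norm z.2 - 1).
pose p (z : R * 'rV[R]_n) := (mu z - 1, mu z *: z.2).
have pC : continuous p by rewrite /p /mu /inv_norm; cont.
have pb z : (@I01 R `*` @unit_ball R n) z -> (@I01 R `*` @unit_ball R n) (p z).
  case: z => t x [/= t01 x1]; have xi := inv_norm_itv x1.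
  move: t01 x1; rewrite /I01 /unit_ball /= => /andP[t0 t1] x1.
  have mu1 : 1 <= mu (t, x) <= inv_norm x by rewrite /mu /=; nra.
  split=> /=; first by rewrite /I01 /=; lra.
  rewrite /unit_ball /= normZ_ge0; last by lra.
  by have := inv_norm_le x; have := normr_ge0 x; nra.
have bm t : I01 t -> t = 0 \/ t = 1 -> ball_map A0 (fun x => g (p (t, x))).
  move=> t01 tE; split.
    apply: (within_compT (f := fun x : 'rV[R]_n => p (t, x)) _ gc).
      by rewrite /p /mu /inv_norm /=; cont.
    by move=> x x1; apply: pb.
  move=> x x1; have [/= pt px] := pb (t, x) (conj t01 x1).
  apply: gA0 => //; case: tE => ->.
    by apply: Or31; rewrite /mu /= mul0r addr0 subrr.
  have muE : mu (1, x) = inv_norm x by rewrite /mu /=; lra.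
  have [x2|/ltW x2] := leP `|x| (1/2).
    by apply: Or32; rewrite muE inv_norm_in //; lra.
  apply: Or33; rewrite normZ_ge0 muE ?inv_norm_out //.
  by have := inv_norm_itv x1; lra.
have sph t x : `|x| = 1 -> p (t, x) = (0, x).
  by move=> x1; rewrite /p /mu /= inv_norm1 // subrr mulr0 addr0 subrr scale1r.
have [|L [Lc LA L0 L1 Lr]] :=
  homotopic_rel_descent E (bm 0 (@I01_0 R) (or_introl erefl))
    (bm 1 (@I01_1 R) (or_intror erefl)).
  exists (fun z => g (p z)); split => //.
  - by apply: (within_compT pC gc pb).
  - by move=> z /pb; exact: gA1.
  - by move=> t x _ x1; rewrite !sph.
(* the inverse of p; where a segment is a point, tau has a zero denominator, and
   L does not depend on tau there *)
pose y (z : R * 'rV[R]_n) := (1 + z.1)^-1 *: z.2.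
pose tau z := z.1 / (inv_norm (y z) - 1).
have zE z : (@I01 R `*` @unit_ball R n) z ->
  [/\ unit_ball (y z), 1 + z.1 <= inv_norm (y z) & I01 (tau z)].
  case: z => t x [/=]; rewrite /I01 /unit_ball /= => /andP[t0 t1] x1.
  have h0 : 0 < (1 + t)^-1 by rewrite invr_gt0; lra.
  have h1 : (1 + t)^-1 * (1 + t) = 1 by rewrite mulVf // gt_eqF //; lra.
  have yn : `|y (t, x)| = (1 + t)^-1 * `|x| by rewrite normZ_ge0 //= ltW.
  have y1 : `|y (t, x)| <= 1 by rewrite yn; nra.
  have t1i : 1 + t <= inv_norm (y (t, x)).
    rewrite /inv_norm -[leLHS]invrK lef_pV2 ?posrE ?lt_max //.
      by rewrite ge_max yn; apply/andP; split; nra.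
    by rewrite divr_gt0 ?orbT.
  split => //; rewrite /tau /=; have [->|tn0] := eqVneq t 0.
    by rewrite mul0r lexx ler01.
  have d0 : 0 < inv_norm (y (t, x)) - 1.
    have : 0 < t by rewrite lt_neqAle eq_sym tn0.
    lra.
  by rewrite divr_ge0 ?(ltW d0) //= ler_pdivrMr // mul1r; lra.
have pK z : (@I01 R `*` @unit_ball R n) z -> p (tau z, y z) = z.
  move=> zD; have [y1 t1i _] := zE _ zD.
  case: z zD y1 t1i => t x [/= /andP[t0 t1] _] y1 t1i.
  have tE : tau (t, x) * (inv_norm (y (t, x)) - 1) = t.
    rewrite /tau /=; have [->|tn0] := eqVneq t 0; first by rewrite !mul0r.
    rewrite mulfVK // gt_eqF //.
    have : 0 < t by rewrite lt_neqAle eq_sym tn0.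
    lra.
  rewrite /p /mu /= tE /y /= scalerA mulfV ?scale1r; last by rewrite gt_eqF //; lra.
  by congr (_, _); lra.
exists (fun z => L (tau z, y z)); split.
- have /continuous_subspaceW : (@I01 R `*` @unit_ball R n) `<=`
      p @` (@I01 R `*` @unit_ball R n).
    by move=> z zD; have [y1 _ t01] := zE _ zD; exists (tau z, y z); rewrite ?pK.
  apply; apply: within_quotient.
  + exact: norm_hausdorff.
  + apply: compact_setX.
      by have := @segment_compact R 0 1; rewrite set_itvcc.
    exact: compact_unit_ball.
  + exact: continuous_subspaceT.
  + apply: eq_within Lc => -[t x] [/= t01 x1].
    have muE : mu (t, x) != 0.
      have := inv_norm_itv x1; move: t01; rewrite /I01 /mu /= => t01 xi.
      by rewrite gt_eqF //; nra.
    have yE : y (p (t, x)) = x.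
      rewrite /y /p /= addrC subrK scalerA mulVf ?scale1r //.
    have [xn1|xn1] := eqVneq `|x| 1.
      rewrite Lr // yE Lr //.
      have [_ _ ] := zE _ (pb (t, x) (conj t01 x1)); exact.
    rewrite yE; congr (L (_, _)); rewrite /tau yE /p /mu /= addrC addKr mulfK //.
    rewrite subr_eq0.
    have [x2|/ltW x2] := leP `|x| (1/2).
      by rewrite inv_norm_in // gt_eqF //; lra.
    apply: contra_neq xn1 => i1; have := inv_norm_out x2.
    by rewrite i1 mul1r.
- by move=> z zD; have [y1 _ t01] := zE _ zD; exact: LA.
- move=> t x t01 x1; have [y1 _ tau01] := zE (t, x) (conj t01 x1).
  have := pK (t, x) (conj t01 x1) => pE.
  have [->|t0] := eqVneq t 0.
    rewrite /tau /= mul0r /y /= addr0 invr1 scale1r L0 //.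
    by rewrite /p /mu /= mul0r addr0 subrr scale1r.
  move=> bd; have tau1 : tau (t, x) = 1.
    have t0' : t <> 0 by exact/eqP.
    have d : inv_norm (y (t, x)) = 1 + t.
      case: bd => // [tE|x1']; [subst t|].
        rewrite inv_norm_in //; move: x1; rewrite /unit_ball /y /= => x1.
        rewrite normZ_ge0; [|by rewrite invr_ge0; lra].
        by rewrite (_ : 1 + 1 = 2 :> R) //; lra.
      move: t01; rewrite /I01 /= => /andP[t0'' t1].
      rewrite /inv_norm /y /= normZ_ge0 ?invr_ge0; last by lra.
      rewrite x1' mulr1 max_l ?invrK // div1r lef_pV2 ?posrE; lra.
    by rewrite /tau /= d (addrC 1) addrK mulfV.
  by rewrite -[in RHS]pE tau1 L1.
Qed.

End Compression.

(** * Extension of homotopies from the sphere to the ball *)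

Section Extension.
Context {R : realType} {T : topologicalType}.

Lemma insert_coord_norm_le q (i : 'I_q.+1) (v : R) x c : 0 <= c ->
  `|insert_coord i v x| <= c <-> `|v| <= c /\ `|x| <= c.
Proof.
move=> c0; split=> [/(rV_norm_le _ c0)|[h1 h2]].
  by move=> /(insert_forall _ (fun r => `|r| <= c)) [? ?]; split=> //; apply/rV_norm_le.
apply/rV_norm_le => //; apply/(insert_forall _ (fun r => `|r| <= c)).
by split=> //; exact/rV_norm_le.
Qed.

Lemma insert_coord_norm1 q (i : 'I_q.+1) (v : R) x : `|v| <= 1 -> `|x| <= 1 ->
  `|insert_coord i v x| = 1 <-> `|v| = 1 \/ `|x| = 1.
Proof.
move=> v1 x1; have le1 : `|insert_coord i v x| <= 1.
  by apply/insert_coord_norm_le.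
split=> [/(rV_norm_eq ltr01 le1)|h].
  move=> /(insert_exists _ (fun r => `|r| = 1)) [?|?]; [by left|right].
  exact/rV_norm_eq.
apply/(rV_norm_eq ltr01 le1); apply/(insert_exists _ (fun r => `|r| = 1)).
by case: h => [?|/(rV_norm_eq ltr01 x1)]; [left|right].
Qed.

(** A ball of positive dimension is a cylinder; in dimension 0 the sphere is empty,
and any point of [A0] will do. *)
Lemma filling (A0 A1 : set T) n (g : 'rV[R]_n -> T) :
  @ball_equivalence R T A0 A1 -> ball_map A1 g ->
  (forall x, `|x| = 1 -> A0 (g x)) ->
  exists2 g', ball_map A0 g' & forall x, `|x| = 1 -> g x = g' x.
Proof.
move=> E [gc gA1] gA0; case: n => [|q] in g gc gA1 gA0 *.
  have [_ /(_ (ex_intro _ (g 0) (gA1 _ (@unit_ball0 _ _))))[a a0] _ _] := E.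
  exists (fun=> a); first by split=> //; apply: continuous_subspaceT; cont.
  by move=> x; rewrite (thinmx0 x) normr0 => /esym /eqP; rewrite oner_eq0.
pose psi (z : R * 'rV[R]_q) := insert_coord ord0 (2 * z.1 - 1) z.2.
have psin t x : I01 t -> unit_ball x -> unit_ball (psi (t, x)).
  rewrite /I01 /unit_ball /= => t01 x1; apply/insert_coord_norm_le => //.
  by split=> //=; rewrite ler_norml; lra.
have [| | |g' [gc' gA' gg']] := filling_cylinder (g := fun z => g (psi z)) E.
- apply: (within_compT _ gc); first by apply: continuous_insert; cont.
  by move=> [t x] [/= ? ?]; exact: psin.
- by move=> [t x] [/= ? ?]; apply/gA1/psin.
- move=> t x t01 x1 bd; apply: gA0; apply/insert_coord_norm1 => //.
    by move: t01; rewrite /I01 ler_norml /=; lra.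
  case: bd => [->|->|]; [left|left|by right].
    by rewrite mulr0 add0r normrN normr1.
  by rewrite mulr1 (_ : 2 - 1 = 1) ?normr1 //; lra.
pose phi (z : 'rV[R]_q.+1) := ((z 0 ord0 + 1) * (1/2), remove_coord ord0 z).
have phiK z : psi (phi z) = z.
  rewrite /psi /phi /= (_ : 2 * _ - 1 = z 0 ord0) ?removeK //; lra.
have phib z : unit_ball z -> I01 (phi z).1 /\ unit_ball (phi z).2.
  rewrite -{1}[z]phiK => /insert_coord_norm_le[] //; rewrite /= ler_norml => h ?.
  by split=> //; rewrite /I01 /=; lra.
exists (fun z => g' (phi z)); first split.
- apply: (within_compT _ gc'); first by apply: continuous_pair;
    [cont|apply: continuous_remove; cont].
  exact: phib.
- by move=> z /phib; exact: gA'.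
move=> z z1; have [|p1 p2] := phib z; first by rewrite /unit_ball /= z1.
rewrite [phi z]surjective_pairing gg' //; first by rewrite -surjective_pairing phiK.
move: z1 p1; rewrite -{1}[z]phiK => + p1; move: (p1); rewrite /I01 /= => p1'.
move=> /insert_coord_norm1[|//|h|]; [by rewrite ler_norml /=; lra| |by apply: Or33].
have [h0|h0] := leP 0 (2 * (phi z).1 - 1).
  by apply: Or32; move: h; rewrite ger0_norm //=; lra.
by apply: Or31; move: h; rewrite ltr0_norm //=; lra.
Qed.

(** The homotopy on the sphere is attached to [f] as a collar, the result is
deformed into [A0] relative to its boundary, and the square of times and radii
is reparametrized so that the deformation takes place away from the collar. *)
Lemma ball_extension (A0 A1 : set T) n (f : 'rV[R]_n -> T)
    (H : R * 'rV[R]_n -> T) :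
  @ball_equivalence R T A0 A1 -> ball_map A1 f ->
  {within @I01 R `*` [set x : 'rV[R]_n | `|x| = 1], continuous H} ->
  (forall t x, I01 t -> `|x| = 1 -> A1 (H (t, x))) ->
  (forall x, `|x| = 1 -> H (0, x) = f x) ->
  (forall x, `|x| = 1 -> A0 (H (1, x))) ->
  exists H' : R * 'rV[R]_n -> T,
    [/\ {within @I01 R `*` @unit_ball R n, continuous H'},
        forall z, (@I01 R `*` @unit_ball R n) z -> A1 (H' z),
        forall x, unit_ball x -> H' (0, x) = f x,
        forall x, unit_ball x -> A0 (H' (1, x)) &
        forall t x, I01 t -> `|x| = 1 -> H' (t, x) = H (t, x)].
Proof.
move=> E [fc fA] Hc HA H0 H1.
pose g (x : 'rV[R]_n) :=
  if `|x| <= 1/2 then f (2 *: x) else H (2 * `|x| - 1, inv_norm x *: x).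
have sph (x : 'rV[R]_n) : 1/2 <= `|x| -> `|inv_norm x *: x| = 1.
  move=> x1; have := inv_norm_out x1 => h; rewrite normZ_ge0 //.
  by rewrite /inv_norm invr_ge0 le_max; apply/orP; lra.
have gE x : 1/2 <= `|x| -> g x = H (2 * `|x| - 1, inv_norm x *: x).
  move=> x1; rewrite /g; case: ifPn => // x2; have xE : `|x| = 1/2 by lra.
  rewrite (_ : 2 * `|x| - 1 = 0); last by lra.
  by rewrite inv_norm_in // H0 // half_scale_norm; lra.
have gA : ball_map A1 g.
  split.
    apply: (@within_paste _ _ _ [set x : 'rV[R]_n | `|x| <= 1/2]
      [set x : 'rV[R]_n | 1/2 <= `|x|] (fun x => f (2 *: x))
      (fun x => H (2 * `|x| - 1, inv_norm x *: x))).
    - by apply: closed_le_fun; cont.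
    - by apply: closed_ge_fun; cont.
    - by move=> x _ /=; have [?|/ltW ?] := leP `|x| (1/2); [left|right].
    - apply: (within_compT (f := fun x : 'rV[R]_n => 2 *: x) _ fc); first by cont.
      by move=> x [_ /= x1]; rewrite /unit_ball /= half_scale_norm; lra.
    - apply: (within_compT _ Hc); first by rewrite /inv_norm; cont.
      move=> x [/= x1 x2]; split=> /=; last exact: sph.
      by move: x1; rewrite /unit_ball /I01 /=; lra.
    - by move=> x _ /= x1; rewrite /g x1.
    - by move=> x _ x1; exact: gE.
  move=> x x1; have [x2|/ltW x2] := leP `|x| (1/2).
    by rewrite /g x2; apply: fA; rewrite /unit_ball /= half_scale_norm; lra.
  rewrite gE //; apply: HA; last exact: sph.
  by move: x1; rewrite /unit_ball /I01 /=; lra.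
have gs x : `|x| = 1 -> g x = H (1, x).
  move=> x1; rewrite gE ?x1; last by lra.
  rewrite (_ : 2 * 1 - 1 = 1); last by lra.
  by rewrite inv_norm1 ?scale1r.
have [g' gA' gg'] := filling E gA (fun x x1 => eq_ind_r A0 (H1 x x1) (gs x x1)).
have [g1 [G [Gc GA G0 G1 Gr]] g1A] := homotopic_into E gA gA' gg'.
(* (tau, k |x|) maps the boundary of the square of all (t, |x|) as follows: t = 0
   to the radii at most 1/2, |x| = 1 along the collar at time 0, and t = 1 to the
   sphere at all times followed by the final map *)
pose tau (z : R * 'rV[R]_n) := z.1 * (2 - Num.max (2 * `|z.2|) 1).
pose k (z : R * 'rV[R]_n) := (1 - z.1) * (1/2) + z.1 * inv_norm z.2.
have kn z : (@I01 R `*` @unit_ball R n) z ->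
    `|k z *: z.2| = (1 - z.1) * (`|z.2| / 2) + z.1 * (inv_norm z.2 * `|z.2|).
  case: z => t x [/=]; rewrite /I01 /= => t01 x1; have xi := inv_norm_itv x1.
  by rewrite normZ_ge0 /k /=; [ring|nra].
have tk z : (@I01 R `*` @unit_ball R n) z -> I01 (tau z) /\ unit_ball (k z *: z.2).
  move=> zD; rewrite /unit_ball /= kn //.
  case: z zD => t x [/=]; rewrite /I01 /unit_ball /tau /= => t01 x1.
  have xl := inv_norm_le x; have x0 := normr_ge0 x; split; last by nra.
  have : 1 <= Num.max (2 * `|x|) 1 <= 2.
    by rewrite le_max lexx orbT ge_max /=; lra.
  by nra.
exists (fun z => G (tau z, k z *: z.2)); split.
- by apply: (within_compT _ Gc); first by rewrite /tau /k /inv_norm; cont.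
- move=> z /tk h; exact: (GA (tau z, k z *: z.2) h).
- move=> x x1; rewrite /tau /k /= mul0r subr0 mul1r mul0r addr0.
  have xn : `|(1/2) *: x| <= 1/2.
    by move: x1; rewrite /unit_ball /= normZ_ge0; lra.
  rewrite G0; last by apply: le_trans xn _; lra.
  rewrite /g xn scalerA.
  by rewrite (_ : 2 * (1/2) = 1 :> R) ?scale1r //; lra.
- move=> x x1; rewrite /tau /k /= subrr mul0r add0r !mul1r.
  have [x2|/ltW x2] := leP `|x| (1/2).
    have -> : 2 - Num.max (2 * `|x|) 1 = 1 by rewrite max_r; lra.
    have h : unit_ball (inv_norm x *: x).
      by rewrite inv_norm_in // /unit_ball /= half_scale_norm; lra.
    rewrite G1; last exact: h.
    exact: g1A.
  have [t01 _] := tk (1, x) (conj (@I01_1 R) x1).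
  rewrite /tau /= mul1r in t01.
  have xs := sph _ x2.
  by rewrite (Gr _ _ t01 xs) (gs _ xs); exact: H1 xs.
- move=> t x t01 x1; have xb : unit_ball x by rewrite /unit_ball /= x1.
  have [_ kb] := tk (t, x) (conj t01 xb).
  have kn1 := kn (t, x) (conj t01 xb); rewrite /= x1 inv_norm1 // in kn1.
  have -> : tau (t, x) = 0 by rewrite /tau /= x1 max_l; lra.
  have k2 : 1/2 <= `|k (t, x) *: x| by move: t01; rewrite kn1 /I01 /=; lra.
  rewrite G0 // gE //; congr (H (_, _)); first by rewrite kn1; lra.
  have kE : k (t, x) = `|k (t, x) *: x|.
    by rewrite kn1 /k /= inv_norm1 //; lra.
  have ii := inv_norm_out k2.
  by rewrite scalerA {2}kE ii scale1r.
Qed.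

End Extension.

(** * Cubes, spheroids and weak equivalences *)

Section Cubes.
Context {R : realType}.

Definition to_ball n (x : 'rV[R]_n) : 'rV[R]_n := 2 *: x - const_mx 1.
Definition to_cube n (y : 'rV[R]_n) : 'rV[R]_n := (1/2) *: (y + const_mx 1).

Lemma to_ballK n : cancel (@to_ball n) (@to_cube n).
Proof.
move=> x; rewrite /to_cube /to_ball subrK scalerA.
by rewrite (_ : 1/2 * 2 = 1 :> R) ?scale1r //; lra.
Qed.

Lemma to_cubeK n : cancel (@to_cube n) (@to_ball n).
Proof.
move=> x; rewrite /to_cube /to_ball scalerA.
by rewrite (_ : 2 * (1/2) = 1 :> R) ?scale1r ?addrK //; lra.
Qed.

Lemma to_ballE n (x : 'rV[R]_n) i : to_ball x 0 i = 2 * x 0 i - 1.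
Proof. by rewrite !mxE. Qed.

Lemma continuous_to_ball (X : topologicalType) n (f : X -> 'rV[R]_n) :
  continuous f -> continuous (fun x => to_ball (f x)).
Proof. by move=> cf; rewrite /to_ball; cont. Qed.

Lemma continuous_to_cube (X : topologicalType) n (f : X -> 'rV[R]_n) :
  continuous f -> continuous (fun x => to_cube (f x)).
Proof.
by move=> cf; rewrite /to_cube; cont.
Qed.

Lemma cubeE n (x : 'rV[R]_n) : cube n x <-> unit_ball (to_ball x).
Proof.
split=> [xc|/(rV_norm_le _ ler01) h i].
  by apply/rV_norm_le => // i; have := xc i; rewrite to_ballE ler_norml; lra.
by have := h i; rewrite to_ballE ler_norml; lra.
Qed.

Lemma cube_boundaryE n (x : 'rV[R]_n) :
  cube_boundary n x <-> `|to_ball x| = 1.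
Proof.
split=> [[/cubeE xc [i xi]]|x1].
  apply/(rV_norm_eq ltr01 xc); exists i; rewrite to_ballE.
  by case: xi => ->; [rewrite mulr0 add0r normrN normr1|rewrite ger0_norm; lra].
have x1' : `|to_ball x| <= 1 by rewrite x1.
split; first exact/cubeE.
have /(rV_norm_eq ltr01 x1') [i] := x1; rewrite to_ballE => xi; exists i.
by move: xi; case: ger0P => _ ?; [right|left]; lra.
Qed.

Lemma closed_cube n : closed (@cube R n).
Proof.
rewrite (_ : cube n = [set x | `|to_ball x| <= 1]); last first.
  by apply/seteqP; split=> x /cubeE.
by apply: closed_le_fun; apply: continuous_normf; apply: continuous_to_ball; cont.
Qed.

Lemma closed_cube_boundary n : closed (@cube_boundary R n).
Proof.
have cb : continuous (fun x : 'rV[R]_n => `|to_ball x|).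
  by apply: continuous_normf; apply: continuous_to_ball; cont.
rewrite (_ : cube_boundary n =
    [set x | `|to_ball x| <= 1] `&` [set x | 1 <= `|to_ball x|]); last first.
  apply/seteqP; split=> x; first by move=> /cube_boundaryE /= ->.
  by move=> [/= h1 h2]; apply/cube_boundaryE; lra.
by apply: closedI; [exact: closed_le_fun|exact: closed_ge_fun].
Qed.

Lemma compact_cube n : compact (@cube R n).
Proof.
rewrite (_ : cube n = @to_cube n @` @unit_ball R n).
  apply: continuous_compact; last exact: compact_unit_ball.
  by apply: continuous_subspaceT; apply: continuous_to_cube; cont.
apply/seteqP; split=> [x /cubeE xb|_ [y yb <-]].
  by exists (to_ball x); rewrite ?to_ballK.
by apply/cubeE; rewrite to_cubeK.
Qed.

Lemma compact_I01 : compact (@I01 R).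
Proof. by have := @segment_compact R 0 1; rewrite set_itvcc. Qed.

Lemma cube_extension (T : topologicalType) (A0 A1 : set T) n (f : 'rV[R]_n -> T)
    (H : R * 'rV[R]_n -> T) :
  @ball_equivalence R T A0 A1 ->
  {within cube n, continuous f} -> (forall x, cube n x -> A1 (f x)) ->
  {within @I01 R `*` cube_boundary n, continuous H} ->
  (forall t x, I01 t -> cube_boundary n x -> A1 (H (t, x))) ->
  (forall x, cube_boundary n x -> H (0, x) = f x) ->
  (forall x, cube_boundary n x -> A0 (H (1, x))) ->
  exists H' : R * 'rV[R]_n -> T,
    [/\ {within @I01 R `*` cube n, continuous H'},
        forall t x, I01 t -> cube n x -> A1 (H' (t, x)),
        forall x, cube n x -> H' (0, x) = f x,
        forall x, cube n x -> A0 (H' (1, x)) &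
        forall t x, I01 t -> cube_boundary n x -> H' (t, x) = H (t, x)].
Proof.
move=> E fc fA Hc HA H0 H1.
have bc y : @unit_ball R n y -> cube n (to_cube y) by rewrite cubeE to_cubeK.
have sc (y : 'rV[R]_n) : `|y| = 1 -> cube_boundary n (to_cube y).
  by rewrite cube_boundaryE to_cubeK.
have [||t y ? /sc ?|y /sc|y /sc|H' [H'c H'A H'0 H'1 H'r]] :=
  @ball_extension R T A0 A1 n (fun y => f (to_cube y))
  (fun z => H (z.1, to_cube z.2)) E.
- split; last by move=> y /bc; exact: fA.
  apply: (within_compT _ fc bc); by apply: continuous_to_cube; cont.
- apply: (within_compT _ Hc).
    by apply: continuous_pair; [cont|apply: continuous_to_cube; cont].
  by move=> [t y] [/= ? /sc].
- exact: HA.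
- exact: H0.
- exact: H1.
exists (fun z => H' (z.1, to_ball z.2)); split.
- apply: (within_compT _ H'c).
    by apply: continuous_pair; [cont|apply: continuous_to_ball; cont].
  by move=> [t x] [/= ? /cubeE].
- by move=> t x t01 /cubeE xb; exact: (H'A (t, to_ball x) (conj t01 xb)).
- by move=> x /cubeE xb; rewrite H'0 ?to_ballK.
- by move=> x /cubeE xb; exact: H'1.
- by move=> t x t01 /cube_boundaryE xb; rewrite H'r //= to_ballK.
Qed.

End Cubes.

Section WeakEquivalencePair.
Context {R : realType} {T : topologicalType}.

Lemma lift_within (X : topologicalType) (D : set X) (A : set T) (g : X -> T) a :
  A a -> {within D, continuous g} -> (forall x, D x -> A (g x)) ->
  exists2 g' : X -> A, {within D, continuous g'} &
    forall x, D x -> set_val (g' x) = g x.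
Proof.
move=> Aa gc gA.
pose g' (x : X) : A := if pselect (D x) is left Dx
  then exist _ (g x) (mem_set (gA _ Dx)) else exist _ a (mem_set Aa).
have g'E x : D x -> set_val (g' x) = g x.
  by move=> Dx; rewrite /g'; case: pselect.
exists g' => //; apply: (@continuous_comp_initial _ (subspace D) _ set_val).
by apply: eq_within gc => x /g'E.
Qed.

Lemma within_set_val (X : topologicalType) (D : set X) (A : set T) (g : X -> A) :
  {within D, continuous g} -> {within D, continuous (fun x => set_val (g x))}.
Proof.
move=> gc; apply: (within_comp (E := setT) gc) => //.
by apply: continuous_subspaceT; exact: initial_continuous.
Qed.

(** Representatives of elements of homotopy groups are maps of cubes into the
subtypes [A0] and [A1]; the ball version speaks of maps into the ambient space
with values in these sets, constant on the sphere. *)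
Lemma weak_equivalence_ball (A0 A1 : set T) (A01 : A0 `<=` A1) :
  weak_homotopy_equivalence R (subset_incl A01) -> @ball_equivalence R T A0 A1.
Proof.
move=> [_ ne W].
have i01 : `[0, 1]%classic = @I01 R by rewrite set_itvcc.
have tbc n : continuous (fun z : R * 'rV[R]_n => (z.1, to_ball z.2)).
  by apply: continuous_pair; [cont|apply: continuous_to_ball; cont].
have tcc n : continuous (fun z : R * 'rV[R]_n => (z.1, to_cube z.2)).
  by apply: continuous_pair; [cont|apply: continuous_to_cube; cont].
have bc n y : @unit_ball R n y -> cube n (to_cube y) by rewrite cubeE to_cubeK.
have sc n (y : 'rV[R]_n) : `|y| = 1 -> cube_boundary n (to_cube y).
  by rewrite cube_boundaryE to_cubeK.
have cb n (x : 'rV[R]_n) : cube n x -> unit_ball (to_ball x) by rewrite cubeE.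
(* a ball map with values in A, constant on the sphere, as a spheroid of A *)
have lift (A : set T) n (s : 'rV[R]_n -> T) (x0 : A) : ball_map A s ->
    (forall y, `|y| = 1 -> s y = set_val x0) ->
    exists2 g : 'rV[R]_n -> A, spheroid x0 g &
      forall x, cube n x -> set_val (g x) = s (to_ball x).
  move=> [sc' sA] s0.
  have [||g gc gE] := @lift_within _ (cube n) A (fun x => s (to_ball x)) _
    (set_valP x0).
  - apply: (within_compT _ sc' (@cb n)); by apply: continuous_to_ball; cont.
  - by move=> x /cb; exact: sA.
  exists g => //; split => // x xb; apply: val_inj.
  by rewrite -[LHS]/(set_val (g x)) gE ?s0 //; [exact/cube_boundaryE|case: xb].
split => //.
- case=> a Aa; have [|x _] := ne; last by exists (set_val x); exact: set_valP.
  by exists (exist _ a (mem_set Aa)).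
- move=> n s x0 sA Ax0 s0 [H [Hc HA H0 H1 Hr]].
  pose x : A0 := exist _ x0 (mem_set Ax0).
  have [g gs gE] := lift A0 n s x sA s0.
  have cs : spheroid x (fun _ : 'rV[R]_n => x).
    by split=> //; apply: continuous_subspaceT; cont.
  have [inj _] := W n x; have [] := inj g (fun=> x) gs cs.
    have [||H' H'c H'E] := @lift_within _ (@I01 R `*` cube n) A1
      (fun z => H (z.1, to_ball z.2)) _ (A01 _ Ax0).
    - by apply: (within_compT (tbc n) Hc) => -[t y] [/= ? /cb].
    - by move=> [t y] [/= ? /cb ?]; exact: HA.
    exists H'; rewrite i01; split=> //.
    + move=> y yc; apply: val_inj; rewrite -[LHS]/(set_val _) H'E /=; last first.
        by split=> //; exact: I01_0.
      by rewrite H0 ?gE //; exact: cb.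
    + move=> y yc; apply: val_inj; rewrite -[LHS]/(set_val _) H'E /=; last first.
        by split=> //; exact: I01_1.
      by rewrite H1 //; exact: cb.
    + move=> t y t01 yb; apply: val_inj; rewrite -[LHS]/(set_val _) H'E /=.
        by rewrite Hr ?s0 //; exact/cube_boundaryE.
      by split=> //; case: yb.
  move=> K []; rewrite i01 => Kc K0 K1 Kr.
  exists (fun z => set_val (K (z.1, to_cube z.2))); split.
  + apply: (within_compT (tcc n) (within_set_val Kc)) => -[t y] [/= ? /bc] //.
  + by move=> z _; exact: set_valP.
  + by move=> y /bc yc; rewrite K0 // gE // to_cubeK.
  + by move=> y /bc yc; rewrite K1.
  + by move=> t y t01 y1; rewrite Kr ?s0 //; exact: sc.
- move=> n s x0 sA Ax0 s0; pose x : A0 := exist _ x0 (mem_set Ax0).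
  have [g gs gE] := lift A1 n s (subset_incl A01 x) sA s0.
  have [_ surj] := W n x; have [h hs [K]] := surj g gs.
  rewrite i01 => -[Kc K0 K1 Kr].
  exists (fun y => set_val (h (to_cube y))).
    split; last by move=> y _; exact: set_valP.
    case: hs => hc _; apply: (within_compT _ (within_set_val hc) (@bc n)).
    by apply: continuous_to_cube; cont.
  exists (fun z => set_val (K (1 - z.1, to_cube z.2))); split.
  + have cc : continuous (fun z : R * 'rV[R]_n => (1 - z.1, to_cube z.2)).
      by apply: continuous_pair; [cont|apply: continuous_to_cube; cont].
    apply: (within_compT cc (within_set_val Kc)) => -[t y] [/= + /bc].
    by rewrite /I01 /= => ? ?; split => //=; lra.
  + by move=> z _; exact: set_valP.
  + by move=> y /bc yc; rewrite subr0 K1 // gE // to_cubeK.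
  + by move=> y /bc yc; rewrite subrr K0.
  + move=> t y t01 y1; rewrite Kr ?s0 //; last exact: sc.
    by move: t01; rewrite /I01 /=; lra.
Qed.

End WeakEquivalencePair.

(** * Extension of small homotopies over a halved cube *)

Section ScaleCoordinate.
Context {R : realType}.

Definition scale_coord q (i : 'I_q.+1) (a b : R) (x : 'rV[R]_q.+1) :=
  insert_coord i (a * x 0 i + b) (remove_coord i x).

Lemma scale_coord_comp q (i : 'I_q.+1) a b c d x :
  scale_coord i a b (scale_coord i c d x) = scale_coord i (a * c) (a * d + b) x.
Proof.
by rewrite /scale_coord insertK insert_at mulrDr !mulrA addrA.
Qed.

Lemma scale_coord_id q (i : 'I_q.+1) x : scale_coord i 1 0 x = x.
Proof. by rewrite /scale_coord mul1r addr0 removeK. Qed.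

Lemma continuous_scale_coord (X : topologicalType) q (i : 'I_q.+1) a b
    (f : X -> 'rV[R]_q.+1) :
  continuous f -> continuous (fun x => scale_coord i a b (f x)).
Proof.
move=> cf; apply: continuous_insert; last exact: continuous_remove.
by apply: continuousDf; [apply: continuousMf|]; cont.
Qed.

Lemma cube_insert q (i : 'I_q.+1) (v : R) x :
  cube q.+1 (insert_coord i v x) <-> 0 <= v <= 1 /\ cube q x.
Proof. exact: (insert_forall i (fun r : R => 0 <= r <= 1)). Qed.

Lemma cube_remove q (i : 'I_q.+1) (x : 'rV[R]_q.+1) :
  cube q.+1 x <-> 0 <= x 0 i <= 1 /\ cube q (remove_coord i x).
Proof. by rewrite -[x in cube _ x](removeK i); exact: cube_insert. Qed.

Lemma cube_boundary_insert q (i : 'I_q.+1) (v : R) x :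
  0 <= v <= 1 -> cube q x ->
  cube_boundary q.+1 (insert_coord i v x) <->
  [\/ v = 0, v = 1 | cube_boundary q x].
Proof.
move=> v01 xc; split.
  case=> _ /(insert_exists i (fun r : R => r = 0 \/ r = 1)).
  by case=> [[]|?]; [exact: Or31|exact: Or32|apply: Or33; split].
move=> h; split; first exact/cube_insert.
apply/(insert_exists i (fun r : R => r = 0 \/ r = 1)).
by case: h => [?|?|[_ ?]]; [left; left|left; right|right].
Qed.

Lemma cube_boundary_remove q (i : 'I_q.+1) (x : 'rV[R]_q.+1) : cube q.+1 x ->
  cube_boundary q.+1 x <->
  [\/ x 0 i = 0, x 0 i = 1 | cube_boundary q (remove_coord i x)].
Proof.
move=> /(cube_remove i)[xi xc].
by rewrite -[x in cube_boundary _ x](removeK i); exact: cube_boundary_insert.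
Qed.

End ScaleCoordinate.

Section ControlledExtension.
Context {R : realType} {T : topologicalType}.

Variables (U : T -> R -> set T) (E0 E1 : set T).

Definition boundary_extension n (f : 'rV[R]_n -> T) (delta eps : R) : Prop :=
  forall H : R * 'rV[R]_n -> T,
  {within @I01 R `*` cube_boundary n, continuous H} ->
  (forall t x, I01 t -> cube_boundary n x -> (E1 `&` U (f x) delta) (H (t, x))) ->
  (forall x, cube_boundary n x -> H (0, x) = f x) ->
  (forall x, cube_boundary n x -> E0 (H (1, x))) ->
  exists H' : R * 'rV[R]_n -> T,
    [/\ {within @I01 R `*` cube n, continuous H'},
        forall t x, I01 t -> cube n x -> (E1 `&` U (f x) eps) (H' (t, x)),
        forall x, cube n x -> H' (0, x) = f x,
        forall x, cube n x -> E0 (H' (1, x)) &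
        forall t x, I01 t -> cube_boundary n x -> H' (t, x) = H (t, x)].

(** The size allowed on the boundary depends on [f] and [eps]: the local
hypothesis holds in neighborhoods whose radii vary along [f]. *)
Definition extendable n (f : 'rV[R]_n -> T) (eps : R) : Prop :=
  exists2 delta : R, 0 < delta & boundary_extension f delta eps.

Hypothesis U_mono : forall x a b, a <= b -> U x a `<=` U x b.

(** The homotopy is extended over the middle face first, and then over the two
halves of the cube, on whose boundaries it is by then defined. *)
Lemma extendable_split q (i : 'I_q.+1) (f : 'rV[R]_q.+1 -> T) eps :
  (forall b, b = 0 \/ b = 1/2 ->
    extendable (fun x => f (scale_coord i (1/2) b x)) eps) ->
  (forall e, 0 < e -> extendable (fun y => f (insert_coord i (1/2) y)) e) ->
  extendable f eps.
Proof.
move=> half mid.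
have [d1 d1_gt0 ext1] := half 0 (or_introl erefl).
have [d2 d2_gt0 ext2] := half (1/2) (or_intror erefl).
have d_gt0 : 0 < Num.min d1 d2 by rewrite lt_min d1_gt0.
have [dF dF_gt0 extF] := mid _ d_gt0.
exists (Num.min dF (Num.min d1 d2)); first by rewrite lt_min dF_gt0.
move=> H Hc HU H0 H1.
have mid_bd (y : 'rV[R]_q) :
    cube_boundary q y -> cube_boundary q.+1 (insert_coord i (1/2) y).
  by move=> yb; apply/cube_boundary_insert; [lra|case: yb|exact: Or33].
have [||y yb|y yb|HF [HFc HFU HF0 HF1 HFr]] :=
    extF (fun z => H (z.1, insert_coord i (1/2) z.2)).
- apply: (within_compT _ Hc).
    by apply: continuous_pair; [cont|apply: continuous_insert; cont].
  by move=> [t y] [/= ? /mid_bd].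
- move=> t y t01 /mid_bd yb; have [? h] := HU _ _ t01 yb; split => //.
  by apply: U_mono h; rewrite ge_min lexx.
- by rewrite /= H0 //; exact: mid_bd.
- by apply: H1; exact: mid_bd.
(* the homotopy is now defined on the boundary and on the middle face *)
pose B : set 'rV[R]_q.+1 :=
  [set x | cube_boundary q.+1 x \/ cube q.+1 x /\ x 0 i = 1/2].
pose H2 (z : R * 'rV[R]_q.+1) := if pselect (cube_boundary q.+1 z.2)
  then H z else HF (z.1, remove_coord i z.2).
have H2bd t (x : 'rV[R]_q.+1) : cube_boundary q.+1 x -> H2 (t, x) = H (t, x).
  by rewrite /H2; case: pselect.
have midx (x : 'rV[R]_q.+1) : x 0 i = 1/2 ->
    insert_coord i (1/2) (remove_coord i x) = x.
  by move=> <-; exact: removeK.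
have H2mid t (x : 'rV[R]_q.+1) : I01 t -> cube q.+1 x -> x 0 i = 1/2 ->
    H2 (t, x) = HF (t, remove_coord i x).
  move=> t01 xc xi; rewrite /H2; case: pselect => // xb.
  rewrite HFr //= ?midx //.
  by have /(cube_boundary_remove i xc)[||] := xb; rewrite // xi; lra.
have H2c : {within @I01 R `*` B, continuous H2}.
  apply: (@within_paste _ _ _ [set z : R * 'rV[R]_q.+1 | cube_boundary q.+1 z.2]
    ([set z : R * 'rV[R]_q.+1 | z.2 0 i <= 1/2] `&`
     [set z : R * 'rV[R]_q.+1 | 1/2 <= z.2 0 i]) H
    (fun z => HF (z.1, remove_coord i z.2))).
  - apply: (closed_comp (f := fun z : R * 'rV[R]_q.+1 => z.2)).
      by move=> z _; exact: continuous_sndT.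
    exact: closed_cube_boundary.
  - by apply: closedI; [apply: closed_le_fun; cont|apply: closed_ge_fun; cont].
  - by move=> [t x] [_ [?|[_ /= xi]]]; [left|right; split => /=; lra].
  - by apply: continuous_subspaceW Hc => -[t x] [[/= ? _] ?].
  - apply: (within_compT _ HFc).
      by apply: continuous_pair; [cont|apply: continuous_remove; cont].
    move=> [t x] [[/= t01 xB] _]; split => //=.
    have /(cube_remove i)[] // : cube q.+1 x by case: xB => [[]|[]].
  - by move=> [t x] _ /= xb; exact: H2bd.
  - move=> [t x] [/= t01 xB] [/= xi1 xi2]; apply: H2mid => //; last by lra.
    by case: xB => [[]|[]].
have H2U t (x : 'rV[R]_q.+1) : I01 t -> B x ->
    (E1 `&` U (f x) (Num.min d1 d2)) (H2 (t, x)).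
  move=> t01 [xb|[xc xi]].
    rewrite H2bd //; have [? h] := HU _ _ t01 xb; split => //.
    by apply: U_mono h; rewrite ge_min lexx orbT.
  have /(cube_remove i)[_ xc'] := xc.
  by rewrite H2mid //; have := HFU t _ t01 xc'; rewrite midx.
have H20 (x : 'rV[R]_q.+1) : B x -> H2 (0, x) = f x.
  case=> [xb|[xc xi]]; first by rewrite H2bd ?H0.
  have /(cube_remove i)[_ xc'] := xc.
  by rewrite H2mid ?HF0 ?midx //; exact: I01_0.
have H21 (x : 'rV[R]_q.+1) : B x -> E0 (H2 (1, x)).
  case=> [xb|[xc xi]]; first by rewrite H2bd //; exact: H1.
  have /(cube_remove i)[_ xc'] := xc.
  by rewrite H2mid //; [exact: HF1|exact: I01_1].
have half_bd (b : R) (x : 'rV[R]_q.+1) : b = 0 \/ b = 1/2 -> cube_boundary q.+1 x ->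
    B (scale_coord i (1/2) b x).
  move=> hb xb; have xc : cube q.+1 x by case: xb.
  have /(cube_remove i)[xi xr] := xc.
  have vi : 0 <= (1/2) * x 0 i + b <= 1 by case: hb => ->; lra.
  have sc : cube q.+1 (scale_coord i (1/2) b x) by exact/cube_insert.
  have [bE|bE] := eqVneq ((1/2) * x 0 i + b) (1/2).
    by right; split => //; rewrite insert_at.
  left; apply/cube_boundary_insert => //.
  move/eqP: bE => bE.
  have /(cube_boundary_remove i xc)[x0|x1|] := xb; last by apply: Or33.
    by apply: Or31; case: hb bE => ->; lra.
  by apply: Or32; case: hb bE => ->; lra.
(* the half [b <= x_i <= b + 1/2] of the cube *)
have step (b d : R) :
  boundary_extension (fun x => f (scale_coord i (1/2) b x)) d eps ->
  b = 0 \/ b = 1/2 -> Num.min d1 d2 <= d ->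
  exists K : R * 'rV[R]_q.+1 -> T, let D := [set x : 'rV[R]_q.+1 | cube q.+1 x /\
      b <= x 0 i <= b + 1/2] in
    [/\ {within @I01 R `*` D, continuous K},
        forall t x, I01 t -> D x -> (E1 `&` U (f x) eps) (K (t, x)),
        forall x, D x -> K (0, x) = f x,
        forall x, D x -> E0 (K (1, x)) &
        forall t x, I01 t -> D x -> B x -> K (t, x) = H2 (t, x)].
  move=> ext hb dd; have [||x xb|x xb|K [Kc KU K0 K1 Kr]] :=
    ext (fun z => H2 (z.1, scale_coord i (1/2) b z.2)).
  - apply: (within_compT _ H2c).
      by apply: continuous_pair; [cont|apply: continuous_scale_coord; cont].
    by move=> [t x] [/= t01 xb]; split=> //=; exact: half_bd.
  - move=> t x t01 xb; have [? h] := H2U _ _ t01 (half_bd _ _ hb xb).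
    by split=> //; exact: U_mono h.
  - by rewrite /= H20 //; exact: half_bd.
  - by apply: H21; exact: half_bd.
  have sK (x : 'rV[R]_q.+1) : scale_coord i (1/2) b (scale_coord i 2 (- 2 * b) x) = x.
    by rewrite scale_coord_comp -[RHS](scale_coord_id i); congr scale_coord; lra.
  have Dc (x : 'rV[R]_q.+1) : cube q.+1 x /\ b <= x 0 i <= b + 1/2 ->
      cube q.+1 (scale_coord i 2 (- 2 * b) x).
    by case=> /(cube_remove i)[xi xr] xb; apply/cube_insert; split=> //; lra.
  exists (fun z => K (z.1, scale_coord i 2 (- 2 * b) z.2)) => D; split.
  - apply: (within_compT _ Kc).
      by apply: continuous_pair; [cont|apply: continuous_scale_coord; cont].
    by move=> [t x] [/= t01 xD]; split=> //=; exact: Dc.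
  - by move=> t x t01 /Dc xD; have := KU _ _ t01 xD; rewrite sK.
  - by move=> x /Dc xD; rewrite /= K0 // sK.
  - by move=> x /Dc xD; exact: K1.
  - move=> t x t01 xD xB; rewrite /= Kr //= ?sK //.
    have /(cube_remove i)[xi xr] := xD.1; case: xD => xc xD.
    apply/cube_boundary_insert; [lra|by []|].
    case: xB => [|[_ xi2]]; last by case: hb => ->; [apply: Or32|apply: Or31]; lra.
    move=> /(cube_boundary_remove i xc)[x0|x1|]; last by apply: Or33.
      by apply: Or31; case: hb xD => ->; lra.
    by apply: Or32; case: hb xD => ->; lra.
have [] := step 0 d1 ext1 (or_introl erefl); first by rewrite ge_min lexx.
move=> K1 /= [K1c K1U K10 K11 K1r].
have [] := step (1/2) d2 ext2 (or_intror erefl); first by rewrite ge_min lexx orbT.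
move=> K2 /= [K2c K2U K20 K21 K2r].
have D1 (x : 'rV[R]_q.+1) : cube q.+1 x -> x 0 i <= 1/2 ->
    cube q.+1 x /\ 0 <= x 0 i <= 0 + 1/2.
  by move=> xc; have /(cube_remove i)[] := xc; split => //; lra.
have D2 (x : 'rV[R]_q.+1) : cube q.+1 x -> 1/2 <= x 0 i ->
    cube q.+1 x /\ 1/2 <= x 0 i <= 1/2 + 1/2.
  by move=> xc; have /(cube_remove i)[] := xc; split => //; lra.
have K12 t (x : 'rV[R]_q.+1) : I01 t -> cube q.+1 x -> x 0 i = 1/2 ->
    K1 (t, x) = K2 (t, x).
  move=> t01 xc xi; have xB : B x by right.
  by rewrite K1r ?K2r //; [apply: D2; rewrite // xi|apply: D1; rewrite // xi].
exists (fun z : R * 'rV[R]_q.+1 => if z.2 0 i <= 1/2 then K1 z else K2 z).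
split.
- apply: (@within_paste _ _ _ [set z : R * 'rV[R]_q.+1 | z.2 0 i <= 1/2]
    [set z : R * 'rV[R]_q.+1 | 1/2 <= z.2 0 i] K1 K2).
  + by apply: closed_le_fun; cont.
  + by apply: closed_ge_fun; cont.
  + by move=> z _ /=; have [?|/ltW ?] := leP (z.2 0 i) (1/2); [left|right].
  + apply: continuous_subspaceW K1c => -[t x] [[/= t01 xc] xi].
    by split=> //; exact: D1.
  + apply: continuous_subspaceW K2c => -[t x] [[/= t01 xc] xi].
    by split=> //; exact: D2.
  + by move=> z _ /= ->.
  + move=> [t x] [/= t01 xc] xi; case: ifPn => // xi'.
    by rewrite K12 //; lra.
- move=> t x t01 xc /=; case: ifPn => xi; first exact/K1U/D1.
  by apply/K2U/D2 => //; lra.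
- move=> x xc /=; case: ifPn => xi; first exact/K10/D1.
  by apply/K20/D2 => //; lra.
- move=> x xc /=; case: ifPn => xi; first exact/K11/D1.
  by apply/K21/D2 => //; lra.
- move=> t x t01 xb /=; have xB : B x by left.
  have xc : cube q.+1 x by case: xb.
  rewrite -H2bd //; case: ifPn => xi; first by rewrite K1r //; exact: D1.
  by rewrite K2r //; apply: D2 => //; lra.
Qed.

End ControlledExtension.

(** * From local to global on the cube *)

Section LocalToCube.
Context {R : realType} {T : topologicalType}.

Variables (U : T -> R -> set T) (E0 E1 : set T).

Hypothesis U_mono : forall x a b, a <= b -> U x a `<=` U x b.
Hypothesis U_trans : forall x y z a b, U x a y -> U y b z -> U x (a + b) z.
Hypothesis U_near : forall x r, E1 x -> 0 < r ->
  \forall y \near x, U x r y /\ U y r x.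
Hypothesis local : forall x, E1 x -> exists2 e0 : R, 0 < e0 &
  forall e, 0 < e -> e < e0 ->
    @ball_equivalence R T (E0 `&` U x e) (E1 `&` U x e).

(** All values of [f] and of the homotopy lie in one neighborhood of [p]; of the
size 3r, one r comes from the distance of [p] to [f x] and two from that
neighborhood. *)
Lemma extendable_small n (f : 'rV[R]_n -> T) p r eps :
  0 < r -> r + r + r <= eps ->
  @ball_equivalence R T (E0 `&` U p (r + r)) (E1 `&` U p (r + r)) ->
  {within cube n, continuous f} ->
  (forall x, cube n x -> [/\ E1 (f x), U p r (f x) & U (f x) r p]) ->
  extendable U E0 E1 f eps.
Proof.
move=> r_gt0 re E fc fU; exists r => // H Hc HU H0 H1.
have [|||H' [H'c H'U H'0 H'1 H'r]] := cube_extension E fc _ Hc _ H0.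
- move=> x /fU[? h _]; split=> //; apply: U_mono h; lra.
- move=> t x t01 xb; have [h1 h2] := HU _ _ t01 xb.
  by have [_ h _] := fU _ xb.1; split=> //; exact: U_trans h2.
- move=> x xb; split; first exact: H1.
  have [_ h2] := HU _ _ (@I01_1 R) xb.
  by have [_ h _] := fU _ xb.1; exact: U_trans h2.
exists H'; split => //.
- move=> t x t01 xc; have [h1 h2] := H'U _ _ t01 xc; split=> //.
  have [_ _ h] := fU _ xc.
  by apply: (U_mono (a := r + (r + r))); [lra|exact: U_trans h2].
- by move=> x /H'1[].
Qed.

Definition box n (a s : 'I_n -> R) (x : 'rV[R]_n) : 'rV[R]_n :=
  \row_j (a j + s j * x 0 j).

Definition unit_subbox n (a s : 'I_n -> R) : Prop :=
  forall j, [/\ 0 <= a j, 0 <= s j & a j + s j <= 1].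

Lemma box_cube n (a s : 'I_n -> R) x :
  unit_subbox a s -> cube n x -> cube n (box a s x).
Proof.
by move=> as1 xc j; rewrite mxE; have [? ? ?] := as1 j; have := xc j; nra.
Qed.

Lemma continuous_box n (a s : 'I_n -> R) : continuous (box a s).
Proof. by apply: continuous_row => j; cont. Qed.

Lemma box_scale_coord q (a s : 'I_q.+1 -> R) (i : 'I_q.+1) (b : R) x :
  box a s (scale_coord i (1/2) b x) =
  box (fun j => if j == i then a j + s j * b else a j)
      (fun j => if j == i then s j * (1/2) else s j) x.
Proof.
apply/rowP => j; rewrite !mxE; case: (unliftP i j) => [k ->|->] /=.
  by rewrite eq_sym (negbTE (neq_lift _ _)) mxE.
by rewrite eqxx; ring.
Qed.

(** Extendability passes from the boxes of side 2^-K to the cube by undoing one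
halving of one coordinate at a time. *)
Lemma extendable_boxes n (f : 'rV[R]_n -> T) eps K :
  (forall q (g : 'rV[R]_q -> T) e, (q < n)%N -> {within cube q, continuous g} ->
    (forall x, cube q x -> E1 (g x)) -> 0 < e -> extendable U E0 E1 g e) ->
  {within cube n, continuous f} -> (forall x, cube n x -> E1 (f x)) ->
  (forall a s, unit_subbox a s -> (forall j, s j = 2 ^- K) ->
    extendable U E0 E1 (fun x => f (box a s x)) eps) ->
  extendable U E0 E1 f eps.
Proof.
move=> faces fc fE1 small.
(* the boxes with the first l coordinates halved k+1 times, the others k times *)
pose Q k l := forall a s, unit_subbox a s ->
  (forall j : 'I_n, s j = if (j < l)%N then 2 ^- k.+1 else 2 ^- k) ->
  extendable U E0 E1 (fun x => f (box a s x)) eps.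
have halve k l : (l < n)%N -> Q k l.+1 -> Q k l.
  case: n => [//|q] in f fc fE1 faces small Q * => ln Qk a s as1 sE.
  pose i := Ordinal ln.
  have iE (j : 'I_q.+1) : (j == i) = (j == l :> nat) by [].
  have half2 : 2 ^- k * (1/2) = 2 ^- k.+1 :> R by rewrite exprSr invfM div1r.
  have k0 : 0 < 2 ^- k.+1 :> R by rewrite invr_gt0 exprn_gt0.
  apply: (extendable_split U_mono (i := i)).
    move=> b hb.
    rewrite (_ : (fun x => _) = fun x => f (box
      (fun j => if j == i then a j + s j * b else a j)
      (fun j => if j == i then s j * (1/2) else s j) x)); last first.
      by apply/funext => x; rewrite box_scale_coord.
    apply: Qk => j.
      have [? ? ?] := as1 j; case: ifP => // _.
      by split; case: hb => bE; rewrite ?bE; nra.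
    rewrite iE ltnS leq_eqVlt; case: eqP => [jl|_] /=; last exact: sE.
    by rewrite sE jl ltnn half2.
  move=> e e_gt0.
  have ic y : cube q y -> cube q.+1 (box a s (insert_coord i (1/2) y)).
    by move=> yc; apply: box_cube => //; apply/cube_insert; split=> //; lra.
  apply: faces => //; last by move=> y /ic; exact: fE1.
  apply: (within_compT _ fc ic).
  move=> y; apply: (@continuous_comp _ _ _ (insert_coord i (1/2)) (box a s)).
    by apply: (@continuous_insert R _ q i (fun=> 1/2) id); cont.
  exact: continuous_box.
have round k : Q k n -> Q k 0.
  suff H l : (l <= n)%N -> Q k n -> Q k (n - l)%N.
    by move=> /(H n (leqnn n)); rewrite subnn.
  elim: l => [|l IH] ln Qn; first by rewrite subn0.
  have := IH (ltnW ln) Qn; rewrite -(subnSK ln); apply: halve.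
  by rewrite ltn_subrL; exact: leq_ltn_trans ln.
have Q0 k : Q k 0 -> Q 0%N 0.
  elim: k => // k IH Qk; apply/IH/round => a s as1 sE; apply: Qk => // j.
  by rewrite sE ltn_ord.
have {}Q0 : Q 0%N 0 by apply: (Q0 K) => a s as1 sE; apply: small.
have := Q0 (fun=> 0) (fun=> 1); rewrite /unit_subbox.
rewrite (_ : (fun x => _) = f).
  by apply=> j; [split; lra|rewrite expr0 invr1].
apply/funext => x; congr f; apply/rowP => j.
by rewrite mxE add0r mul1r.
Qed.

(** Induction on the dimension, which provides the middle faces of all
subdivisions with arbitrarily small homotopies; a fine subdivision consists of
boxes that fall under the local hypothesis. *)
Theorem extendable_cube n (f : 'rV[R]_n -> T) eps :
  {within cube n, continuous f} -> (forall x, cube n x -> E1 (f x)) ->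
  0 < eps -> extendable U E0 E1 f eps.
Proof.
elim/ltn_ind: n => n IH in f eps * => fc fE1 eps_gt0.
pose good (p : T) (r : R) := [/\ 0 < r, r + r + r <= eps &
  @ball_equivalence R T (E0 `&` U p (r + r)) (E1 `&` U p (r + r))].
pose P (e : R) (x : 'rV[R]_n) := exists p r, good p r /\
  forall y, cube n y -> `|x - y| < e -> U p r (f y) /\ U (f y) r p.
have Pnear : \forall e \near (0 : R)^'+, @cube R n `<=` P e.
  apply: ((compact_near_coveringP _).1 (@compact_cube R n)).
  move=> x xc; have [e0 e0_gt0 loc] := local (fE1 x xc).
  pose r := Num.min (e0 / 3) (eps / 3).
  have r_gt0 : 0 < r by rewrite lt_min !divr_gt0.
  have re0 : r <= e0 / 3 by rewrite ge_min lexx.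
  have re : r <= eps / 3 by rewrite ge_min lexx orbT.
  have nearf : nbhs x [set y | cube n y -> U (f x) r (f y) /\ U (f y) r (f x)].
    have /subspace_continuousP fc' := fc.
    have := fc' x xc _ (U_near (fE1 x xc) r_gt0).
    by rewrite /nbhs /= /fmap /= /within /=.
  have [d /= d_gt0 Hd] := (nbhs_ballP _ _).1 nearf.
  exists (ball x (d / 2), [set e | e < d / 2]) => /=.
    split; first by apply: nbhsx_ballx; rewrite divr_gt0.
    by apply: nbhs_right_lt; rewrite divr_gt0.
  move=> [x' e] [/= xx' ed]; exists (f x), r; split.
    by split; [|lra|apply: loc; lra].
  move=> y yc x'y; apply: Hd => //.
  rewrite -ball_normE /= in xx' *.
  have -> : x - y = (x - x') + (x' - y) by rewrite addrA subrK.
  by apply: le_lt_trans (ler_normD _ _) _; lra.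
have [e [He e_gt0]] : exists e, @cube R n `<=` P e /\ 0 < e.
  exact: (@filter_ex R (0^'+) _ _ (filterI Pnear (nbhs_right_gt 0))).
have [K Ke] : exists K, 2 ^- K < e.
  have h := upper_nthrootP (leqnn (Num.Def.archi_bound e^-1)).
  exists (Num.Def.archi_bound e^-1).
  by rewrite -[ltRHS]invrK ltf_pV2 ?posrE ?invr_gt0 ?exprn_gt0.
apply: (extendable_boxes (K := K)) => //.
  by move=> q g e' qn gc gE1 e'_gt0; exact: IH.
move=> a s as1 sE.
have [|p [r [[r_gt0 re E] Hr]]] := He (\row_j a j).
  by move=> j; rewrite mxE; have [? ? ?] := as1 j; lra.
apply: (extendable_small r_gt0 re E).
  by apply: (within_compT _ fc); [exact: continuous_box|move=> x; exact: box_cube].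
move=> x xc; have xc' := box_cube as1 xc.
have [] := Hr _ xc'; last by move=> ? ?; split => //; exact: fE1.
apply: le_lt_trans Ke; apply/rV_norm_le => [|j].
  by rewrite invr_ge0 exprn_ge0.
rewrite !mxE opprD addrA subrr add0r normrN sE.
have := xc j; have : 0 <= 2 ^- K :> R by rewrite invr_ge0 exprn_ge0.
by move=> k0 xj; rewrite ger0_norm; nra.
Qed.

End LocalToCube.

(** * Compactness and finiteness of CW complexes *)

Section Compactness.

(** Otherwise the complements of the sets covered by finitely many [V x] form a
proper filter, and no point is a cluster point of it. *)
Lemma compact_finite_nbhs (X : topologicalType) (V : X -> set X) :
  compact [set: X] -> (forall x, nbhs x (V x)) ->
  exists s : seq X, forall y, exists2 x, x \in s & V x y.
Proof.
move=> Xco VX; apply: contrapT => nocover.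
pose F : set_system X := [set A | exists s : seq X,
  forall y, ~ A y -> exists2 x, x \in s & V x y].
have FF : ProperFilter F.
  split=> [[s h]|]; first by apply: nocover; exists s => y; exact: h.
  split=> [|A B [s hs] [t ht]|A B AB [s hs]].
  - by exists [::] => y; case.
  - exists (s ++ t) => y /not_andP[/hs|/ht] [x xs Vx]; exists x => //;
      by rewrite mem_cat xs ?orbT.
  - by exists s => y nB; apply: hs => /AB.
have [|y [_ yF]] := Xco F FF; first by exists [::] => y; case.
have FV : F (~` V y).
  by exists [:: y] => z /contrapT Vz; exists y; rewrite ?mem_head.
by have [z []] := yF _ _ FV (VX y).
Qed.

Lemma hausdorff_prod (X Y : topologicalType) :
  hausdorff_space X -> hausdorff_space Y -> hausdorff_space (X * Y)%type.
Proof.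
move=> hX hY [x y] [x' y'] cl; congr (_, _).
  apply: hX => A B xA x'B; have [||[u v] [/= ? ?]] := cl (fst @^-1` A) (fst @^-1` B).
  - exact: (@continuous_fstT X Y (x, y)).
  - exact: (@continuous_fstT X Y (x', y')).
  - by exists u.
apply: hY => A B xA x'B; have [||[u v] [/= ? ?]] := cl (snd @^-1` A) (snd @^-1` B).
- exact: (@continuous_sndT X Y (x, y)).
- exact: (@continuous_sndT X Y (x', y')).
- by exists v.
Qed.

Lemma closed_within_preimage (X Y : topologicalType) (D : set X) (f : X -> Y)
    (B : set Y) :
  closed D -> {within D, continuous f} -> closed B -> closed (D `&` f @^-1` B).
Proof.
move=> Dcl fc Bcl; have fB := (continuous_closedP _).1 fc _ Bcl.
have [F Fcl FE] := (closed_subspaceP _ _).1 fB.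
by rewrite setIC -FE; exact: closedI.
Qed.

End Compactness.

Section CWComplexes.
Context {R : realType} {K : topologicalType}.
Variable S : CW_structure R K.

Local Notation bd e := (cube_boundary (cell_dim e)).
Local Notation ocell e := (open_cell (@char_map R K S e)).

Lemma cube_open_or_boundary n (x : 'rV[R]_n) :
  cube n x -> open_cube n x \/ cube_boundary n x.
Proof.
move=> xc; have [|nb] := pselect (cube_boundary n x); [by right|left=> i].
have := xc i; rewrite !lt_neqAle => /andP[-> ->]; rewrite !andbT.
by apply/andP; split; apply/eqP => xi; apply: nb; split=> //; exists i;
  [left|right].
Qed.

Lemma open_cube_cube n (x : 'rV[R]_n) : open_cube n x -> cube n x.
Proof. by move=> xo i; have := xo i; lra. Qed.

(** A set with one point in each cell is closed and discrete, because each closed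
cell meets finitely many cells. *)
Lemma finite_cells : compact [set: K] -> finite_set [set: cell S].
Proof.
move=> Kco.
pose p (e : cell S) : K := char_map e (const_mx (1/2)).
have pe e : ocell e (p e).
  by exists (const_mx (1/2)) => // i; rewrite mxE; lra.
have pinj e e' : p e = p e' -> e = e'.
  by move=> pp; apply: (cell_disjoint (pe e)); rewrite pp; exact: pe.
have Hcl : forall A : set K, finite_set A -> closed A.
  by apply/accessible_finite_set_closed/hausdorff_accessible/(cw_hausdorff S).
have clp (C : set (cell S)) : closed (p @` C).
  apply: (cw_weak_topology (c := S)) => e.
  have [F [Ffin _ Fe]] := closure_finite e.
  rewrite (_ : _ `&` _ = cube (cell_dim e) `&`
      char_map e @^-1` (p @` (C `&` (F `|` [set e])))).
    apply: closed_within_preimage; [exact: closed_cube|exact: char_map_continuous|].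
    apply: Hcl; apply: finite_image; apply: finite_setIr.
    by rewrite finite_setU; split=> //; exact: finite_set1.
  apply/seteqP; split=> x [xc [e' Ce' pE]]; split=> //; exists e' => //; last first.
    by case: Ce'.
  split=> //; case: (cube_open_or_boundary xc) => [xo|xb].
    right; apply: cell_disjoint (pe e') _; rewrite pE; by exists x.
  have [|e'' Fe'' xe''] := Fe (char_map e x); first by exists x.
  left; rewrite (cell_disjoint (pe e') (e' := e'')) //.
  by rewrite pE.
have [s hs] := @compact_finite_nbhs _
  (fun y => ~` (p @` [set e | p e <> y])) Kco
  (fun y => open_nbhs_nbhs (conj (closed_openC (clp _)) (fun h =>
     let: ex_intro2 e ne pe' := h in ne pe'))).
have fs : finite_set [set` s] by apply/finite_seqP; exists s.
apply: (@sub_finite_set _ _ (p @^-1` [set` s])); last first.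
  by apply: finite_preimage fs => e e' _ _; exact: pinj.
move=> e _ /=; have [y ys h] := hs (p e).
suff -> : p e = y by [].
by apply: contrapT => ne; apply: h; exists e.
Qed.

End CWComplexes.

(** * Extension cell by cell *)

Lemma seq_argmax (T : eqType) (f : T -> nat) (s : seq T) : s != [::] ->
  exists2 x, x \in s & forall y, y \in s -> (f y <= f x)%N.
Proof.
elim: s => // x s IH _; have [->|sn] := eqVneq s [::].
  by exists x; rewrite ?mem_head // => y; rewrite inE => /eqP ->.
have [z zs h] := IH sn; have [le|lt] := leqP (f z) (f x).
  exists x; first exact: mem_head.
  by move=> y; rewrite inE => /orP[/eqP ->//|/h h']; exact: leq_trans h' le.
exists z; first by rewrite inE zs orbT.
by move=> y; rewrite inE => /orP[/eqP ->|/h //]; exact: ltnW.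
Qed.

Section CellByCell.
Context {R : realType} {T K : topologicalType}.
Variables (U : T -> R -> set T) (E0 E1 : set T).
Variables (S : CW_structure R K) (G : set K) (phi : K -> T).

Local Notation ocell e := (open_cell (@char_map R K S e)).

Definition controlled_homotopy (X : set K) (eps : R) : Prop :=
  exists Phi : R * K -> T,
  [/\ {within @I01 R `*` X, continuous Phi},
      forall t k, I01 t -> X k -> (E1 `&` U (phi k) eps) (Phi (t, k)),
      forall k, X k -> Phi (0, k) = phi k,
      forall k, X k -> E0 (Phi (1, k)) &
      forall t k, I01 t -> G k -> Phi (t, k) = phi k].

Hypothesis phi_cont : continuous phi.
Hypothesis phi_E1 : forall k, E1 (phi k).
Hypothesis phi_E0 : forall k, G k -> E0 (phi k).
Hypothesis U_refl : forall x r, 0 < r -> U x r x.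
Hypothesis U_mono : forall x a b, a <= b -> U x a `<=` U x b.
Hypothesis extend : forall n (f : 'rV[R]_n -> T) eps,
  {within cube n, continuous f} -> (forall x, cube n x -> E1 (f x)) ->
  0 < eps -> extendable U E0 E1 f eps.

(** The extension over the cube descends to the closed cell because the
characteristic map is a quotient map, even after multiplication with the time
interval. *)
Lemma controlled_homotopy_attach (X : set K) (e : cell S) :
  closed X -> G `<=` X ->
  char_map e @` cube_boundary (cell_dim e) `<=` X ->
  (forall k, ocell e k -> ~ X k) ->
  (forall eps, 0 < eps -> controlled_homotopy X eps) ->
  forall eps, 0 < eps ->
    controlled_homotopy (X `|` char_map e @` cube (cell_dim e)) eps.
Proof.
move=> Xcl GX bdX oX IH eps eps_gt0.
have Kh := cw_hausdorff S.
have ec := @char_map_continuous R K S e.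
pose n := cell_dim e; pose c := char_map e.
pose f (x : 'rV[R]_n) := phi (c x).
have fc : {within cube n, continuous f}.
  by apply: (within_comp (E := setT) ec) => //; exact: continuous_subspaceT.
have [d d_gt0 ext] := extend fc (fun x _ => phi_E1 (c x)) eps_gt0.
have de_gt0 : 0 < Num.min d eps by rewrite lt_min d_gt0.
have [Phi [Pc PU P0 P1 PG]] := IH _ de_gt0.
have bX x : cube_boundary n x -> X (c x) by move=> xb; apply: bdX; exists x.
have tc : {within @I01 R `*` cube n, continuous (fun z => (z.1, c z.2))}.
  apply: within_pair; first by apply: continuous_subspaceT; cont.
  apply: (@within_compT _ _ _ _ _ (fun z : R * 'rV[R]_n => z.2) c _ ec).
    by cont.
  by move=> z [].
have [|t x t01 /bX b|x /bX|x /bX|H [Hc HU H0 H1 Hr]] :=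
    ext (fun z => Phi (z.1, c z.2)).
- apply: (within_comp _ Pc) => [|[t x] [/= ? /bX]] //.
  by apply: continuous_subspaceW tc => -[t x] [/= ? []].
- by have [? h] := PU _ _ t01 b; split=> //; apply: U_mono h; rewrite ge_min lexx.
- exact: P0.
- exact: P1.
pose g (k : K) := xget 0 [set x | open_cube n x /\ c x = k].
pose Psi (z : R * K) := if pselect (X z.2) then Phi z else H (z.1, g z.2).
have PsiX t k : X k -> Psi (t, k) = Phi (t, k).
  by rewrite /Psi; case: pselect.
have Psic t x : I01 t -> cube n x -> Psi (t, c x) = H (t, x).
  move=> t01 xc; rewrite /Psi; case: pselect => /= [Xx|nXx].
    have [xo|xb] := cube_open_or_boundary xc; last by rewrite Hr.
    by case: (oX (c x)) => //; exists x.
  have [xo|/bX//] := cube_open_or_boundary xc.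
  have [go gE] : open_cube n (g (c x)) /\ c (g (c x)) = c x.
    by apply: (@xgetPex _ 0 [set y | open_cube n y /\ c y = c x]); exists x.
  by rewrite (char_map_inj go xo gE).
exists Psi; split.
- apply: (@within_paste _ _ _ [set z : R * K | X z.2]
    [set z : R * K | (c @` cube n) z.2] Phi Psi) => //.
  + by apply: (closed_comp (f := fun z : R * K => z.2)) => // z _;
      exact: continuous_sndT.
  + apply: (closed_comp (f := fun z : R * K => z.2)).
      by move=> z _; exact: continuous_sndT.
    by apply: compact_closed => //; apply: continuous_compact => //; exact: compact_cube.
  + by move=> z [_ ]; case; [left|right].
  + by apply: continuous_subspaceW Pc => -[t k] [[/= ? _] ?].
  + apply: (@continuous_subspaceW _ _ _
      ((fun z => (z.1, c z.2)) @` (@I01 R `*` cube n))).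
      by move=> [t k] [[/= t01 _] [x xc xk]]; exists (t, x) => //=; rewrite xk.
    apply: within_quotient.
    * by apply: hausdorff_prod => //; exact: norm_hausdorff.
    * by apply: compact_setX; [exact: compact_I01|exact: compact_cube].
    * exact: tc.
    * by apply: eq_within Hc => -[t x] [/= t01 xc]; rewrite Psic.
  + by move=> [t k] _ /=; exact: PsiX.
- move=> t k t01 [Xk|[x xc <-]]; last first.
    by rewrite Psic //; exact: HU.
  rewrite PsiX //; have [? h] := PU _ _ t01 Xk; split => //.
  by apply: U_mono h; rewrite ge_min lexx orbT.
- move=> k [Xk|[x xc <-]]; first by rewrite PsiX //; exact: P0.
  by rewrite Psic ?H0 //; exact: I01_0.
- move=> k [Xk|[x xc <-]]; first by rewrite PsiX //; exact: P1.
  by rewrite Psic //; [exact: H1|exact: I01_1].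
- by move=> t k t01 Gk; rewrite PsiX ?PG //; exact: GX.
Qed.

(** A cell of maximal dimension can be removed: boundaries of the other cells do
not meet it. *)
Lemma controlled_homotopy_cells (s : seq {classic cell S}) :
  closed G -> (exists C : set (cell S), G = \bigcup_(e in C) ocell e) ->
  (forall e : {classic cell S}, e \in s ->
    char_map (e : cell S) @` cube_boundary (cell_dim (e : cell S)) `<=`
    [set k | exists e' : {classic cell S}, [/\ e' \in s,
       (cell_dim (e' : cell S) < cell_dim (e : cell S))%N &
       ocell (e' : cell S) k]]) ->
  let X := G `|` [set k | exists2 e : {classic cell S}, e \in s &
    ocell (e : cell S) k] in
  closed X /\ forall eps, 0 < eps -> controlled_homotopy X eps.
Proof.
move=> Gcl [C GE]; have [N] := ubnP (size s); elim: N s => // N IH s sN sbd X.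
have [s0|sn] := eqVneq s [::].
  rewrite (_ : X = G); last first.
    by apply/seteqP; split=> [k [//|[e]]|k]; [rewrite s0|left].
  split=> // eps eps_gt0; exists (fun z => phi z.2); split => //.
  - by apply: continuous_subspaceT => z; apply: continuous_comp;
      [exact: continuous_sndT|exact: phi_cont].
  - by move=> t k _ _; split; [exact: phi_E1|exact: U_refl].
have [e es emax] := seq_argmax
  (fun e : {classic cell S} => cell_dim (e : cell S)) sn.
pose s' := [seq e' <- s | e' != e].
pose X' := G `|` [set k | exists2 e : {classic cell S}, e \in s' &
    ocell (e : cell S) k].
have s's e' : e' \in s' -> e' \in s by rewrite mem_filter => /andP[].
have lts' e' : e' \in s -> (cell_dim (e' : cell S) < cell_dim (e : cell S))%N ->
    e' \in s'.
  move=> e's lt; rewrite mem_filter e's andbT; apply/eqP => ee'.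
  by move: lt; rewrite ee' ltnn.
have [X'cl X'h] : closed X' /\ forall eps, 0 < eps -> controlled_homotopy X' eps.
  apply: IH.
    apply: leq_trans (_ : size s <= N)%N => //.
    rewrite size_filter -(count_predC (fun e' => e' != e) s) -addn1 leq_add2l.
    by rewrite -has_count; apply/hasP; exists e => //=; rewrite eqxx.
  move=> e1 e1s k /(sbd _ (s's _ e1s))[e' [e's lt ke']]; exists e'; split => //.
  by apply: lts' => //; apply: leq_trans lt _; apply: emax; exact: s's.
have bdX' : char_map (e : cell S) @` cube_boundary (cell_dim (e : cell S)) `<=` X'.
  by move=> k /(sbd _ es)[e' [e's lt ke']]; right; exists e' => //; exact: lts'.
have [eC|neC] := pselect (C e).
  rewrite (_ : X = X') //; apply/seteqP; split=> k [Gk|[e' e's ke']]; try by left.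
    have [ee|ne] := eqVneq e' e; last by right; exists e'; rewrite // mem_filter ne.
    by left; rewrite GE; exists e => //; rewrite -ee.
  by right; exists e' => //; exact: s's.
have XE : X = X' `|` char_map (e : cell S) @` cube (cell_dim (e : cell S)).
  apply/seteqP; split=> k.
    case=> [Gk|[e' e's ke']]; first by left; left.
    have [ee|ne] := eqVneq e' e; last first.
      by left; right; exists e'; rewrite // mem_filter ne.
    right; move: ke'; rewrite ee => -[x xo <-]; exists x => //.
    exact: open_cube_cube.
  case=> [[Gk|[e' e's ke']]|[x xc <-]]; [by left|by right; exists e' => //; exact: s's|].
  have [xo|xb] := cube_open_or_boundary xc; first by right; exists e => //; exists x.
  have [|Gk|[e' e's ke']] := bdX' (char_map (e : cell S) x); first by exists x.
    by left.
  by right; exists e' => //; exact: s's.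
rewrite XE; split.
  apply: closedU => //; apply: compact_closed; first exact: (cw_hausdorff S).
  by apply: continuous_compact; [exact: char_map_continuous|exact: compact_cube].
apply: controlled_homotopy_attach => //; first by move=> k; left.
move=> k ke [|[e' e's ke']].
  by rewrite GE => -[e' Ce' ke']; apply: neC; rewrite (cell_disjoint ke ke').
have := cell_disjoint ke ke' => ee; move: e's; rewrite mem_filter => /andP[].
by rewrite -ee eqxx.
Qed.

Lemma controlled_homotopy_CW : compact [set: K] -> subcomplex S G ->
  forall eps, 0 < eps -> controlled_homotopy setT eps.
Proof.
move=> Kco [Gcl GC] eps eps_gt0.
have /(@finite_seqP {classic cell S}) [s sE] := finite_cells S Kco.
have ins (e : {classic cell S}) : e \in s.
  by have : [set` s] e by rewrite -sE.
have [|_ h] := @controlled_homotopy_cells s Gcl GC.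
  move=> e _ k; have [F [_ Fd Fe]] := closure_finite (e : cell S).
  by move=> /Fe[e' Fe' ke']; exists e'; split => //; exact: Fd.
suff <- : G `|` [set k | exists2 e : {classic cell S}, e \in s &
    ocell (e : cell S) k] = setT by exact: h.
apply/seteqP; split=> // k _; right.
by have [e ke] := cell_cover S k; exists e.
Qed.

End CellByCell.

(** * Neighborhoods of embeddings *)

Section EmbeddingSpace.
Context {R : realType} {n m : nat} {N : manifold R n} {M : manifold R m}.
Variables (ref : N -> M) (d : M -> M -> R).
Hypothesis N_compact : compact [set: N].
Hypothesis d_dist : compatible_distance d.

Lemma open_whitney_base (B : set (Emb ref)) : whitney_base B -> open B.
Proof.
move=> wB; exists [set B]; last by rewrite bigcup_set1.
move=> _ ->; exists (finmap.fset1 B).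
  by move=> A; rewrite finmap.in_fset1 => /eqP ->; exact: mem_set.
by apply/seteqP; split=> [f h|f Bf A]; [apply: h; rewrite /= finmap.in_fset1|
  rewrite /= finmap.in_fset1 => /eqP ->].
Qed.

(** Points close to [phi x] in a chart are close to it in [M], because the inverse
of the chart is continuous. The set [A] is so small that its image lies within
half of both bounds, which leaves the other half for [w]. *)
Lemma chart_control (phi : Emb ref) (r : R) (x : N) : 0 < r ->
  exists t : half_chart R n N * half_chart R m M * set N * R,
    let: (c, c', A, e) := t in
    [/\ atlas c /\ atlas c', compact A, A `<=` dom c, phi @` A `<=` dom c' &
        [/\ 0 < e, nbhs x A & forall z w, A z -> dom c' w ->
          `|Defs.coord c' w - Defs.coord c' (phi z)| < e -> d w (phi z) < r]].
Proof.
move=> r_gt0; have [d0 d00 dC dT dN] := d_dist.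
have [c ca cx] := atlas_cover x; have [c' ca' cx'] := atlas_cover (phi x).
have r2 : 0 < r / 2 by rewrite divr_gt0.
have Bx : nbhs (phi x) [set w | d (phi x) w < r / 2].
  by apply/dN; exists (r / 2).
have /subspace_continuousP pc := @param_continuous _ _ _ c'.
have Bp : nbhs (param c' (Defs.coord c' (phi x))) [set w | d (phi x) w < r / 2].
  by rewrite coordK.
have pB : nbhs (Defs.coord c' (phi x)) [set v | (Defs.coord c' @` dom c') v ->
    d (phi x) (param c' v) < r / 2].
  exact: (pc _ (ex_intro2 _ _ (phi x) cx' erefl) _ Bp).
have [e /= e_gt0 He] := (nbhs_ballP _ _).1 pB.
have e2 : 0 < e / 2 by rewrite divr_gt0.
have /subspace_continuousP cc := @Defs.coord_continuous _ _ _ c'.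
have cB : nbhs (phi x) [set w | dom c' w ->
    ball (Defs.coord c' (phi x)) (e / 2) (Defs.coord c' w)].
  by apply: (cc _ cx' (ball (Defs.coord c' (phi x)) (e / 2))); exact: nbhsx_ballx.
have [[phic _] _ _ _] := emb_smooth phi.
have phiB : nbhs x (phi @^-1` ([set w | d (phi x) w < r / 2] `&`
    ([set w | dom c' w -> ball (Defs.coord c' (phi x)) (e / 2) (Defs.coord c' w)] `&`
    dom c'))).
  apply: phic; apply: filterI => //; apply: filterI => //.
  by apply: open_nbhs_nbhs; split=> //; exact: open_dom.
have cN : nbhs x (dom c) by apply: open_nbhs_nbhs; split=> //; exact: open_dom.
have [A xA AB] := compact_regular (manifold_hausdorff (m := N)) N_compact
  filterT (filterI phiB cN).
exists (c, c', closure A, e / 2); split=> //.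
- by apply: subclosed_compact N_compact _ => //; exact: closed_closure.
- by move=> z /AB[].
- by move=> _ [z /AB[[_ [_ ?]] _] <-].
split=> //; first by apply: filterS xA; exact: subset_closure.
move=> z w /AB[[/= dz [bz cz]] _] cw zw.
have {}bz := bz cz; rewrite -ball_normE /= in bz.
have dw : d (phi x) w < r / 2.
  have := He (Defs.coord c' w); rewrite /= coordK //; apply; last by exists w.
  rewrite -ball_normE /=.
  rewrite (_ : _ - _ = (Defs.coord c' (phi x) - Defs.coord c' (phi z)) +
    (Defs.coord c' (phi z) - Defs.coord c' w)); last by rewrite addrA subrK.
  by apply: le_lt_trans (ler_normD _ _) _; rewrite distrC in zw; lra.
by apply: le_lt_trans (dT _ (phi x) _) _; rewrite dC; lra.
Qed.

(** Compactness of [N] reduces uniform closeness to closeness of order 0 in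
finitely many charts. *)
Lemma nbhs_uniform (phi : Emb ref) (r : R) : 0 < r ->
  nbhs phi [set psi : Emb ref | forall x, d (psi x) (phi x) < r].
Proof.
move=> r_gt0; have [t tP] := choice (fun x => chart_control phi x r_gt0).
have tN x : nbhs x (t x).1.2.
  by have := tP x; case: (t x) => [[[c c'] A] e] [_ _ _ _ []].
have [[|x0 s'] sP] := compact_finite_nbhs N_compact tN.
  by apply: filterS filterT => psi _ x; have [] := sP x.
set s := x0 :: s' in sP.
pose tj j := t (nth x0 s j).
pose B := whitney_nbhd phi 0 [set j | (j < size s)%N] (fun j => (tj j).1.1.1)
  (fun j => (tj j).1.1.2) (fun j => (tj j).1.2) (fun j => (tj j).2).
have wB : whitney_base B.
  exists phi, 0%N, [set j | (j < size s)%N], (fun j => (tj j).1.1.1),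
    (fun j => (tj j).1.1.2), (fun j => (tj j).1.2), (fun j => (tj j).2).
  split=> //; split=> [x|j _].
    exists setT; first exact: filterT.
    by apply: sub_finite_set (finite_II (size s)) => j [].
  by have := tP (nth x0 s j); rewrite /tj; case: (t _) => [[[c c'] A] e] [? ? ? ? []].
have Bphi : B phi.
  move=> j _; split.
    by have := tP (nth x0 s j); rewrite /tj; case: (t _) => [[[c c'] A] e] [].
  move=> x al _ _; rewrite subrr normr0.
  by have := tP (nth x0 s j); rewrite /tj; case: (t _) => [[[c c'] A] e] [_ _ _ _ []].
have : nbhs phi B by apply: open_nbhs_nbhs; split=> //; exact: open_whitney_base.
apply: filterS => psi Bpsi x; have [y ys Ax] := sP x.
have js : (index y s < size s)%N by rewrite index_mem.
have [+ +] := Bpsi (index y s) js; rewrite /tj nth_index //.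
have := tP y; move: Ax; case: (t y) => [[[c c'] A] e] /= Ax.
move=> [_ _ Ac _ [_ _ ctrl]] psiA near.
apply: ctrl => //; first by apply: psiA; exists x.
by have := near x [::] Ax (leq0n _); rewrite /= /local_rep /= coordK //; exact: Ac.
Qed.

Lemma C0_nbhdP (phi psi : Emb ref) (e : R) :
  C0_nbhd d phi e psi <-> forall x, exists y, d (psi x) (phi y) < e.
Proof.
have [d0 _ _ _ _] := d_dist; split=> h x.
  have [|_ [_ [y _ <-] <-] ?] := inf_lt _ (h x); last by exists y.
  by exists (d (psi x) (phi x)); exists (phi x) => //; exists x.
have [y dy] := h x; apply: le_lt_trans dy; apply: ge_inf.
  by exists 0 => _ [w _ <-]; exact: d0.
by exists (phi y) => //; exists y.
Qed.

Lemma C0_nbhd_mono (phi : Emb ref) (a b : R) :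
  a <= b -> C0_nbhd d phi a `<=` C0_nbhd d phi b.
Proof. by move=> ab psi h x; exact: lt_le_trans (h x) ab. Qed.

Lemma C0_nbhd_refl (phi : Emb ref) (e : R) : 0 < e -> C0_nbhd d phi e phi.
Proof.
have [_ d00 _ _ _] := d_dist.
by move=> e_gt0; apply/C0_nbhdP => x; exists x; rewrite (d00 _ _).2.
Qed.

Lemma C0_nbhd_trans (f g h : Emb ref) (a b : R) :
  C0_nbhd d f a g -> C0_nbhd d g b h -> C0_nbhd d f (a + b) h.
Proof.
have [_ _ _ dT _] := d_dist.
move=> /C0_nbhdP fg /C0_nbhdP gh; apply/C0_nbhdP => x.
have [y hy] := gh x; have [z gz] := fg y; exists z.
by apply: le_lt_trans (dT _ (g y) _) _; lra.
Qed.

Lemma C0_nbhd_near (phi : Emb ref) (r : R) : 0 < r ->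
  nbhs phi [set psi : Emb ref | C0_nbhd d phi r psi /\ C0_nbhd d psi r phi].
Proof.
move=> r_gt0; have [_ _ dC _ _] := d_dist.
apply: filterS (nbhs_uniform phi r_gt0) => psi h.
by split; apply/C0_nbhdP => x; exists x; rewrite ?h // dC.
Qed.

End EmbeddingSpace.

(** * Local equivalences give a small deformation *)

Theorem theorem5p2p2 (R : realType) (n m : nat)
    (N : manifold R n) (M : manifold R m)
    (N_compact : compact [set: N])
    (d : M -> M -> R) (d_distance : compatible_distance d)
    (ref : N -> M) (ref_embedding : boundary N !=set0 -> smooth_embedding ref)
    (E0 E1 : set (Emb ref)) (E01 : E0 `<=` E1)
    (E0_dense : E1 `<=` closure E0)
    (local_equivalence : forall phi : Emb ref, E1 phi ->
       exists2 eps0 : R, 0 < eps0 &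
         forall eps : R, 0 < eps -> eps < eps0 ->
           weak_homotopy_equivalence R
             (subset_incl (@setSI _ (C0_nbhd d phi eps) _ _ E01))) :
  C0_dense_weak_equivalence d E0 E1.
Proof.
move=> eps eps_gt0 K S G Kco GS phi phic phiE1 phiE0.
have mono := @C0_nbhd_mono R n m N M ref d.
have ext k (f : 'rV[R]_k -> Emb ref) e : {within cube k, continuous f} ->
    (forall x, cube k x -> E1 (f x)) -> 0 < e ->
    extendable (C0_nbhd d) E0 E1 f e.
  apply: extendable_cube => //.
  - exact: C0_nbhd_trans.
  - by move=> psi r _; exact: C0_nbhd_near.
  - move=> psi /local_equivalence[e0 e0_gt0 loc]; exists e0 => // r r_gt0 r_lt.
    exact: weak_equivalence_ball (loc r r_gt0 r_lt).
have [Phi [Pc PU P0 P1 PG]] := controlled_homotopy_CW phic phiE1 phiE0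
  (@C0_nbhd_refl _ _ _ _ _ ref d d_distance) mono ext Kco GS eps_gt0.
exists (fun z => Phi (z.2, z.1)); split; last split; last split.
- apply: (within_compT _ Pc); first by cont.
  by move=> [k t] [_] /=; rewrite in_itv.
- by move=> k t t01; have [] := PU t k t01 Logic.I.
- by move=> k; exact: P0.
- by move=> k t Gk t01; exact: PG.
- by move=> k; exact: P1.
- by move=> k t t01; have [] := PU t k t01 Logic.I.
Qed.
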